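(* Let $G$ be a polycyclic-by-finite group and let $A$ be a finite-dimensional vector space over a field $K$. Let $\Sigma \subset A^G$ be a strongly irreducible linear subshift and let $\tau \colon \Sigma \to \Sigma$ be a linear cellular automaton. Then the limit set $\Omega(\tau) = \bigcap_{n \geq 1} \tau^n(\Sigma)$ is the largest (with respect to inclusion) strongly irreducible linear subshift $\Lambda \subset A^G$ contained in $\Sigma$ such that $\tau(\Lambda) \subset \Lambda$ and $\tau|_{\Lambda} \colon \Lambda \to \Lambda$ is pre-injective. (That is, $\Omega(\tau)$ itself has these properties, and it contains every $\Lambda$ having them.)
   Context: A group $G$ is polycyclic if it admits a finite sequence of subgroups $G = G_0 \supset G_1 \supset \cdots \supset G_n = \{1_G\}$ such that $G_{i+1}$ is normal in $G_i$ and $G_i/G_{i+1}$ is a (possibly infinite) cyclic group for all $i$; it is polycyclic-by-finite if it admits a polycyclic subgroup of finite index. $A^G$ is the $K$-vector space of all maps $x \colon G \to A$, equipped with the prodiscrete topology (product topology with each factor $A$ discrete) and with the shift action $(gx)(h) = x(g^{-1}h)$. A linear subshift of $A^G$ is a closed $G$-invariant vector subspace of $A^G$. A subshift $\Sigma \subset A^G$ is strongly irreducible if there exists a finite subset $\Delta \subset G$ such that for all $x, y \in \Sigma$ and all finite subsets $E, F \subset G$ with $E \cap F\Delta = \varnothing$, there exists $z \in \Sigma$ with $z|_E = x|_E$ and $z|_F = y|_F$. A linear cellular automaton $A^G \to A^G$ is a map $\tilde\tau$ for which there exist a finite subset $M \subset G$ and a $K$-linear map $\mu \colon A^M \to A$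 with $\tilde\tau(x)(g) = \mu((g^{-1}x)|_M)$ for all $x \in A^G$, $g \in G$. A linear cellular automaton between linear subshifts $\Sigma_1 \to \Sigma_2$ of $A^G$ is a map that is the restriction of a linear cellular automaton $A^G \to A^G$. A cellular automaton $\tau \colon \Sigma_1 \to \Sigma_2$ is pre-injective if whenever $x, y \in \Sigma_1$ coincide outside a finite subset of $G$ and $\tau(x) = \tau(y)$, then $x = y$. *)

(* Defs.v *)
From HB Require Import structures.
From mathcomp Require Import all_boot all_order all_algebra finmap.
From mathcomp Require Import all_classical topology.

Set Implicit Arguments.
Unset Strict Implicit.
Unset Printing Implicit Defensive.

Import GRing.Theory.

Local Open Scope classical_set_scope.
Local Open Scope ring_scope.

Section PolycyclicByFinite.
Variable G : groupType.

Definition is_subgroup (H : set G) : Prop :=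
  [/\ H 1%g,
      forall x y, H x -> H y -> H (x * y)%g
    & forall x, H x -> H x^-1%g].

Definition is_normal_in (N H : set G) : Prop :=
  N `<=` H /\ forall h x, H h -> N x -> N (h * x * h^-1)%g.

Definition left_coset (H : set G) (g : G) : set G := [set (g * h)%g | h in H].

Definition expgz (g : G) (n : int) : G :=
  match n with Posz k => (g ^+ k)%g | Negz k => (g ^- k.+1)%g end.

(* H / N is cyclic, its elements being the cosets x N with x in H: there is a
   generator g N, i.e. every x N equals (g N)^n = g^n N for some integer n. *)
Definition cyclic_quotient (H N : set G) : Prop :=
  exists2 g : G, H g &
    forall x, H x -> exists n : int, left_coset N x = left_coset N (expgz g n).

Definition polycyclic (H : set G) : Prop :=
  exists (n : nat) (S : nat -> set G),
    [/\ S 0%N = H,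
        S n = [set 1%g],
        forall i, (i <= n)%N -> is_subgroup (S i)
      & forall i, (i < n)%N ->
          is_normal_in (S i.+1) (S i) /\ cyclic_quotient (S i) (S i.+1)].

Definition finite_index (H : set G) : Prop := finite_set (range (left_coset H)).

Definition polycyclic_by_finite : Prop :=
  exists H : set G, [/\ is_subgroup H, polycyclic H & finite_index H].

End PolycyclicByFinite.

Section LinearSubshifts.
Variables (K : fieldType) (A : vectType K) (G : groupType).
Implicit Types (Sigma : set (G -> A)) (tau : (G -> A) -> (G -> A)).

Definition shift (g : G) (x : G -> A) : G -> A := fun h => x (g^-1 * h)%g.

Definition prodiscrete_closed Sigma : Prop :=
  closed (Sigma : set {ptws G -> discrete_topology A}).

Definition shift_invariant Sigma : Prop :=
  forall g x, Sigma x -> Sigma (shift g x).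

Definition vector_subspace Sigma : Prop :=
  [/\ Sigma 0,
      forall x y, Sigma x -> Sigma y -> Sigma (x + y)
    & forall (a : K) x, Sigma x -> Sigma (a *: x)].

Definition linear_subshift Sigma : Prop :=
  [/\ prodiscrete_closed Sigma, shift_invariant Sigma & vector_subspace Sigma].

Definition strongly_irreducible Sigma : Prop :=
  exists D : {fset G}, forall x y, Sigma x -> Sigma y ->
    forall E F : {fset G},
      (E `&` [fset (f * d)%g | f in F, d in D])%fset = fset0 ->
      exists z, [/\ Sigma z, {in E, z =1 x} & {in F, z =1 y}].

Definition full_linear_CA tau : Prop :=
  exists (M : {fset G}) (mu : {linear (M -> A) -> A}),
    forall x g, tau x g = mu (fun m : M => shift g^-1 x (val m)).

(* A map Sigma1 -> Sigma2 is encoded by a total function on A^G sending Sigma1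
   into Sigma2; its values outside Sigma1 are irrelevant. *)
Definition linear_CA Sigma1 Sigma2 tau : Prop :=
  set_fun Sigma1 Sigma2 tau /\
  exists2 T, full_linear_CA T & forall x, Sigma1 x -> tau x = T x.

Definition pre_injective Sigma tau : Prop :=
  forall x y, Sigma x -> Sigma y ->
    (exists F : {fset G}, forall g, g \notin F -> x g = y g) ->
    tau x = tau y -> x = y.

Definition limit_set Sigma tau : set (G -> A) :=
  \bigcap_(n in [set n | (1 <= n)%N]) (iter n tau @` Sigma).

End LinearSubshifts.

(* Main.v *)
Require Import Defs.
From HB Require Import structures.
From mathcomp Require Import all_boot all_order all_algebra finmap.
From mathcomp Require Import all_classical topology.

(* A polycyclic-by-finite group has a finite-index subgroup H that is
   poly-(infinite cyclic).  By the Hilbert basis argument (Hall's theorem)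
   both the finitely supported configurations and the linear functionals on
   A^G depending on finitely many coordinates are Noetherian K[H]-modules.

   By linear compactness, the images of linear subshifts under tau are linear
   subshifts.  A closed subspace of A^G is the common kernel of its annihilator
   among the functionals above, so that linear subshifts satisfy the descending
   chain condition: the sequence tau^k(Sigma) stabilizes at the limit set, on
   which tau is surjective.

   The Garden of Eden theorem replaces amenability by the following fact about
   a Noetherian module M over K[H], which has no zero divisors because H has
   unique products: if Phi is an injective endomorphism of M, then a K[H]-linear
   map f : M -> K[H] vanishing on Phi(M) vanishes, since otherwise f(m) <> 0
   would make the sum of the Phi^i(K[H] m) direct.  Applied to functionals
   modulo the annihilator it shows that surjective automata are pre-injective;
   applied to the finitely supported configurations, which are dense by strong
   irreducibility, it shows that pre-injective automata are surjective. *)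

Set Implicit Arguments.
Unset Strict Implicit.
Unset Printing Implicit Defensive.

Import Order.TTheory GRing.Theory Num.Theory.
Local Open Scope classical_set_scope.

Lemma seq_argmax (d : Order.disp_t) (T : eqType) (R : orderType d) (f : T -> R)
    (s : seq T) : s != [::] ->
  exists2 x, x \in s & forall y, y \in s -> (f y <= f x)%O.
Proof.
elim: s => // x s IH _; have [->|/IH[y ys ymax]] := eqVneq s [::].
  by exists x; rewrite ?mem_head // => y; rewrite inE => /eqP ->.
have [xy|yx] := leP (f x) (f y).
  exists y; first by rewrite inE ys orbT.
  by move=> z; rewrite inE => /predU1P[-> //|/ymax].
exists x; first exact: mem_head.
by move=> z; rewrite inE => /predU1P[-> //|/ymax/le_trans]; apply; exact: ltW.
Qed.

Section CyclicExtensions.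
Variable G : groupType.
Local Open Scope group_scope.
Implicit Types (N H P : set G) (g x y : G) (s t : seq G) (m n z : int).

Lemma expgz0 g : expgz g 0 = 1.
Proof. by []. Qed.

Lemma expgzN g n : expgz g (- n)%R = (expgz g n)^-1.
Proof. by case: n => [[|k]|k] /=; rewrite ?expg0 ?invg1 ?invgK. Qed.

Lemma expgzD g m n : expgz g (m + n)%R = expgz g m * expgz g n.
Proof.
have expgzS k : expgz g (1 + k)%R = g * expgz g k.
  case: k => [k|[|k]] /=; [exact: expgS|by rewrite expg0 expg1 mulgV|].
  by rewrite subn1 (expgSr g k.+1) invgM mulVKg.
have expgz_natD (k : nat) l : expgz g (k%:Z + l)%R = expgz g k * expgz g l.
  elim: k => [|k IH]; first by rewrite add0r expgz0 mul1g.
  by rewrite intS -addrA !expgzS IH mulgA.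
case: m => k; first exact: expgz_natD.
apply: (mulgI (g ^+ k.+1)); rewrite -[g ^+ k.+1]/(expgz g k.+1) -expgz_natD.
by rewrite NegzE addrA subrr add0r expgzN mulVKg.
Qed.

Lemma expgzX g k z : expgz (g ^+ k) z = expgz g (z * k%:Z)%R.
Proof.
case: z => l /=; first by rewrite -expgnA mulnC.
by rewrite NegzE mulNr expgzN -PoszM /= -expgnA mulnC.
Qed.

Lemma subgroup_expgz H g z : is_subgroup H -> H g -> H (expgz g z).
Proof.
case=> H1 HM HV Hg.
have HX k : H (g ^+ k) by elim: k => [|k IH] //; rewrite expgS; exact: HM.
by case: z => k //=; exact: HV.
Qed.

Definition normaliser N : set G := [set g | forall x, N (x ^ g) <-> N x].

Lemma normaliser_subgroup N : is_subgroup (normaliser N).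
Proof.
split=> [x|g h gN hN x|g gN x]; first by rewrite conjg1.
  by rewrite conjgM; exact: iff_trans (hN _) (gN _).
by rewrite -(gN (x ^ g^-1)) conjgKV.
Qed.

Lemma normaliser_conj N g z x : normaliser N g -> N x -> N (x ^ expgz g z).
Proof. by move/(subgroup_expgz z (normaliser_subgroup N)) => gN /gN. Qed.

Definition cyclic_extension N g : set G :=
  [set n * expgz g z | n in N & z in setT].

Inductive poly_Z : set G -> Prop :=
| poly_Z_trivial : poly_Z [set 1]
| poly_Z_extension N g : poly_Z N -> normaliser N g ->
    (forall k, ~ N (g ^+ k.+1)) -> poly_Z (cyclic_extension N g).

Lemma trivial_subgroup : is_subgroup [set (1 : G)].
Proof. by split => [//|x y -> ->|x ->]; rewrite ?mulg1 ?invg1. Qed.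

Lemma cyclic_extension_subgroup N g :
  is_subgroup N -> normaliser N g -> is_subgroup (cyclic_extension N g).
Proof.
move=> [N1 NM NV] gN; split.
- by exists 1 => //; exists 0%R => //; rewrite expgz0 mulg1.
- move=> _ _ [n Nn [y _ <-]] [m Nm [z _ <-]].
  exists (n * m ^ expgz g (- y)%R); first by apply: NM; last exact: normaliser_conj.
  by exists (y + z)%R => //; rewrite expgzN expgzD conjgE !gnorm.
- move=> _ [n Nn [z _ <-]].
  exists (n^-1 ^ expgz g z); first by apply: normaliser_conj; last exact: NV.
  by exists (- z)%R => //; rewrite expgzN conjgE !gnorm.
Qed.

Lemma sub_cyclic_extension N g : N `<=` cyclic_extension N g.
Proof. by move=> x Nx; exists x => //; exists 0%R => //; rewrite expgz0 mulg1. Qed.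

Lemma expgz_cyclic_extension N g z :
  is_subgroup N -> cyclic_extension N g (expgz g z).
Proof. by case=> N1 _ _; exists 1 => //; exists z => //; rewrite mul1g. Qed.

Lemma cyclic_extension_min N g H : is_subgroup H -> N `<=` H -> H g ->
  cyclic_extension N g `<=` H.
Proof.
move=> sH NH Hg _ [n /NH Hn [z _ <-]]; have [_ HM _] := sH.
by apply: HM => //; exact: subgroup_expgz.
Qed.

Lemma poly_Z_subgroup H : poly_Z H -> is_subgroup H.
Proof.
by elim=> [|N g _ sN gN _]; [exact: trivial_subgroup|exact: cyclic_extension_subgroup].
Qed.

Definition has_unique_products H := forall s t, s != [::] -> t != [::] ->
  (forall x, x \in s -> H x) -> (forall y, y \in t -> H y) ->
  exists x y, [/\ x \in s, y \in t & forall x' y', x' \in s -> y' \in t ->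
    x' * y' = x * y -> x' = x /\ y' = y].

Section UniqueProducts.
Variables (N : set G) (g : G).
Hypotheses (sN : is_subgroup N) (gN : normaliser N g).
Hypothesis Ng_torsion_free : forall k, ~ N (g ^+ k.+1).

Lemma cyclic_extension_exponent : exists e : G -> int,
  (forall x y, cyclic_extension N g x -> cyclic_extension N g y ->
    e (x * y) = (e x + e y)%R) /\
  (forall x, cyclic_extension N g x -> N (x * expgz g (- e x)%R)).
Proof.
have [_ NM NV] := sN.
have expgz_eq0 z : N (expgz g z) -> z = 0%R.
  by case: z => [[//|k]/Ng_torsion_free|k /NV] //=; rewrite invgK => /Ng_torsion_free.
have /choice[e eN] : forall x, exists z,
    cyclic_extension N g x -> N (x * expgz g (- z)%R) => [x|].
  have [[n Nn [z _ <-]]|nx] := pselect (cyclic_extension N g x); last by exists 0%R.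
  by exists z => _; rewrite expgzN mulgK.
exists e; split=> // x y Hx Hy; have [_ HM _] := cyclic_extension_subgroup sN gN.
apply/eqP; rewrite -subr_eq0; apply/eqP/expgz_eq0.
have := NM _ _ (NV _ (eN _ (HM _ _ Hx Hy)))
  (NM _ _ (eN _ Hx) (normaliser_conj (- e x)%R gN (eN _ Hy))).
by rewrite conjgE expgzD !expgzN expgzD !gnorm.
Qed.

(* The products of the elements of largest exponent are, up to
   conjugation, products in [N]. *)
Lemma cyclic_extension_unique_products :
  has_unique_products N -> has_unique_products (cyclic_extension N g).
Proof.
move=> upN s t s0 t0 sH tH; have [e [eM eN]] := cyclic_extension_exponent.
have [x0 x0s x0max] := seq_argmax e s0; have [y0 y0t y0max] := seq_argmax e t0.
set a := e x0 in x0max; set b := e y0 in y0max.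
pose s' := [seq x * expgz g (- a)%R | x <- s & e x == a].
pose t' := [seq (y * expgz g (- b)%R) ^ expgz g (- a)%R | y <- t & e y == b].
have mem_s' x : x \in s -> e x = a -> x * expgz g (- a)%R \in s'.
  by move=> xs xa; apply: map_f; rewrite mem_filter xa eqxx.
have mem_t' y : y \in t -> e y = b -> (y * expgz g (- b)%R) ^ expgz g (- a)%R \in t'.
  by move=> yt yb; apply: map_f; rewrite mem_filter yb eqxx.
have [||||_ [_ [/mapP[x + ->] /mapP[y + ->] uniq_xy]]] := upN s' t'.
- by apply: contraTneq (mem_s' _ x0s erefl) => ->.
- by apply: contraTneq (mem_t' _ y0t erefl) => ->.
- by move=> _ /mapP[x + ->]; rewrite mem_filter => /andP[/eqP <- /sH/eN].
- move=> _ /mapP[y + ->]; rewrite mem_filter => /andP[/eqP <- /tH/eN].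
  exact: normaliser_conj.
rewrite !mem_filter => /andP[/eqP xa xs] /andP[/eqP yb yt].
exists x, y; split=> // x' y' x's y't xy'.
have exy : (e x' + e y' = a + b)%R by rewrite -eM ?xy' ?eM ?xa ?yb; auto.
have x'a : e x' = a.
  apply/eqP; rewrite eq_le x0max //= -(lerD2r b) -exy lerD2l; exact: y0max.
have y'b : e y' = b by move: exy; rewrite x'a => /addrI.
have [|/mulIg -> /conjg_inj/mulIg -> //] :=
  uniq_xy _ _ (mem_s' _ x's x'a) (mem_t' _ y't y'b).
by rewrite !conjgE !expgzN !gnorm -!mulgA (mulgA x') xy' !mulgA.
Qed.

End UniqueProducts.

Lemma poly_Z_unique_products H : poly_Z H -> has_unique_products H.
Proof.
elim=> [|N g /poly_Z_subgroup sN upN gN Ng]; last first.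
  exact: cyclic_extension_unique_products.
move=> [//|x s] [//|y t] _ _ s1 t1; exists x, y; rewrite !mem_head; split=> //.
by move=> x' y' /s1 -> /t1 -> _; rewrite (s1 x (mem_head _ _)) (t1 y (mem_head _ _)).
Qed.

End CyclicExtensions.

Lemma nat_pigeonhole (T : finType) (f : nat -> T) :
  exists i j, (i < j)%N /\ f i = f j.
Proof.
have /injectivePn[i [j ij fij]] : ~~ injectiveb (fun k : 'I_#|T|.+1 => f k).
  by apply/injectiveP => /leq_card; rewrite card_ord ltnn.
have [lt|lt|/val_inj e] := ltngtP i j; [by exists i, j|by exists j, i|].
by rewrite e eqxx in ij.
Qed.

Section PolycyclicGroups.
Variable G : groupType.
Local Open Scope group_scope.
Implicit Types (N H P : set G) (g x y : G).

Definition finite_index_in H N :=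
  exists t : seq G, forall x, H x -> exists2 c, c \in t & N (c^-1 * x).

Definition finitely_generated H := exists2 s : seq G, (forall x, x \in s -> H x) &
  forall P, is_subgroup P -> (forall x, x \in s -> P x) -> H `<=` P.

Lemma finite_index_in_refl H : finite_index_in H H.
Proof. by exists [:: 1] => x Hx; exists 1; rewrite ?mem_head // invg1 mul1g. Qed.

Lemma finite_index_in_trans H N P :
  finite_index_in H N -> finite_index_in N P -> finite_index_in H P.
Proof.
move=> [s sH] [t tN]; exists [seq x * y | x <- s, y <- t] => x /sH[c cs /tN[d dt Pd]].
by exists (c * d); rewrite ?invgM -?mulgA //; exact: allpairs_f.
Qed.

Lemma finite_index_setT H : is_subgroup H -> finite_index H -> finite_index_in setT H.
Proof.
move=> [H1 _ _] fH; pose r C := xget 1 [set g | left_coset H g = C].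
have /finite_seqP[t te] : finite_set (r @` range (left_coset H)) by exact: finite_image.
exists t => x _; pose C := left_coset H x.
have rC : left_coset H (r C) = C.
  exact: (@xgetPex _ 1 [set g | left_coset H g = C] (ex_intro _ x erefl)).
exists (r C).
  suff: (r @` range (left_coset H)) (r C) by rewrite te.
  by exists C => //; exists x.
have : left_coset H (r C) x by rewrite rC; exists 1; rewrite ?mulg1.
by move=> [h Hh xE]; rewrite -[in X in _ * X]xE mulKg.
Qed.

Lemma polycyclic_ind (P : set G -> Prop) : P [set 1] ->
  (forall N g, polycyclic N -> is_subgroup N -> normaliser N g -> P N ->
    P (cyclic_extension N g)) ->
  forall H, polycyclic H -> P H.
Proof.
move=> P1 Pext H [n [S [<- Sn sS step]]].
elim: n S Sn sS step => [|n IH] S Sn sS step; first by rewrite Sn.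
have sS1 i : (i <= n)%N -> is_subgroup (S i.+1) by exact: (sS i.+1).
have stepS i : (i < n)%N -> is_normal_in (S i.+2) (S i.+1) /\
    cyclic_quotient (S i.+1) (S i.+2) by exact: (step i.+1).
have [[S10 nS1] [g Sg genS]] := step 0%N isT.
have [_ _ SV] := sS 0%N isT.
have gN : normaliser (S 1%N) g.
  by move=> x; split=> [/(nS1 g _ Sg)|/(nS1 _ _ (SV _ Sg))]; rewrite conjgE !gnorm.
have -> : S 0%N = cyclic_extension (S 1%N) g.
  apply/seteqP; split; last exact: (cyclic_extension_min (sS 0%N isT)).
  move=> x /genS[z exz]; have : left_coset (S 1%N) x x.
    by exists 1; rewrite ?mulg1 //; case: (sS1 0%N isT).
  rewrite exz => -[n0 Nn0 <-]; exists (n0 ^ expgz g (- z)%R).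
    exact: normaliser_conj.
  by exists z => //; rewrite conjgE expgzN !gnorm.
apply: Pext => //; [|exact: sS1|exact: (IH (fun i => S i.+1))].
by exists n, (fun i => S i.+1).
Qed.

Lemma polycyclic_finitely_generated H : polycyclic H -> finitely_generated H.
Proof.
move: H; apply: polycyclic_ind => [|N g _ sN gN [s s_sub s_gen]].
  by exists [::] => // P [P1 _ _] _ _ ->.
exists (g :: s) => [x|P sP sgP].
  rewrite inE => /predU1P[->|/s_sub/sub_cyclic_extension//].
  exact: (expgz_cyclic_extension g 1).
apply: cyclic_extension_min => //; last by apply: sgP; exact: mem_head.
by apply: s_gen => // x xs; apply: sgP; rewrite inE xs orbT.
Qed.

Definition coset_agreement N N0 a b : set G :=
  [set x | N x /\ forall y, N y -> N0 ((x ^ a * y)^-1 * (x ^ b * y))].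

Lemma coset_agreement_subgroup N N0 a b : is_subgroup N -> is_subgroup N0 ->
  normaliser N a -> normaliser N b -> is_subgroup (coset_agreement N N0 a b).
Proof.
move=> [N1 NM NV] [O1 OM OV] aN bN; split.
- by split=> // y _; rewrite !conj1g !gnorm.
- move=> x x' [Nx Ox] [Nx' Ox']; split=> [|y Ny]; first exact: NM.
  have Nx'y : N (x' ^ a * y) by apply: NM => //; exact/aN.
  by have := OM _ _ (Ox _ Nx'y) (Ox' y Ny); rewrite !conjMg !gnorm.
- move=> x [Nx Ox]; split=> [|y Ny]; first exact: NV.
  have Nxy : N ((x ^ b)^-1 * y) by apply: NM => //; exact/NV/bN.
  by have := OV _ (Ox _ Nxy); rewrite !conjVg !gnorm.
Qed.

(* After conjugation by a power of [g], each of the finitely many generators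
   permutes the finitely many cosets of [N0]: two powers induce the same
   permutations. *)
Lemma powers_coset_agreement N N0 g : is_subgroup N -> is_subgroup N0 -> N0 `<=` N ->
  finitely_generated N -> finite_index_in N N0 -> normaliser N g ->
  exists i j, (i < j)%N /\ N `<=` coset_agreement N N0 (g ^+ i) (g ^+ j).
Proof.
move=> sN sN0 N0N [s s_sub s_gen] [t tN] gN.
have [_ NM NV] := sN; have [_ OM OV] := sN0.
have gXN k : normaliser N (g ^+ k).
  exact: (@subgroup_expgz _ _ _ k (normaliser_subgroup N)).
have /choice[rep repP] : forall y, exists c, N y -> c \in t /\ N0 (c^-1 * y).
  move=> y; have [/tN[c ct Oc]|] := pselect (N y); last by exists 1.
  by exists c.
pose table j : {ffun seq_sub s * seq_sub t -> option (seq_sub t)} :=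
  [ffun p => insub (rep (val p.1 ^ (g ^+ j) * val p.2))].
have [i [j [ij table_ij]]] := nat_pigeonhole table.
exists i, j; split=> //; apply: s_gen; first exact: coset_agreement_subgroup.
move=> x xs; split=> [|y Ny]; first exact: s_sub.
have [c ct Oc] := tN y Ny.
have Nc : N c by rewrite -[c](mulgK (c^-1 * y)) mulVKg; exact/NM/NV/N0N.
have Nxc k : N (x ^ (g ^+ k) * c) by apply: NM => //; exact/gXN/s_sub.
have [[it Oi] [jt Oj]] := (repP _ (Nxc i), repP _ (Nxc j)).
have := congr1 (fun d : {ffun _} => d (SeqSub xs, SeqSub ct)) table_ij.
rewrite !ffunE /= !insubT => -[e]; rewrite e in Oi.
have := OM _ _ (OV _ Oc) (OM _ _ (OM _ _ (OV _ Oi) Oj) Oc).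
by rewrite !gnorm.
Qed.

Lemma power_normalises N N0 g : is_subgroup N -> is_subgroup N0 -> N0 `<=` N ->
  finitely_generated N -> finite_index_in N N0 -> normaliser N g ->
  exists k, normaliser N0 (g ^+ k.+1).
Proof.
move=> sN sN0 N0N fN iN gN; have [N1 _ _] := sN; have [_ OM OV] := sN0.
have [i [j [ij agree_ij]]] := powers_coset_agreement sN sN0 N0N fN iN gN.
exists (j - i).-1; rewrite prednK ?subn_gt0 // => x.
have gXN z : normaliser N (expgz g z).
  exact: subgroup_expgz (normaliser_subgroup N) gN.
have fix_coset : N x -> N0 (x^-1 * x ^ (g ^+ (j - i))).
  move=> /(gXN (- i%:Z)%R)/agree_ij[_ /(_ 1 N1)].
  rewrite !mulg1 expgzN -!conjgM mulVg conjg1.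
  by rewrite -{1}(subnKC (ltnW ij)) expgnDr mulKg.
split=> Ox; last by have := OM _ _ Ox (fix_coset (N0N _ Ox)); rewrite mulVKg.
have /fix_coset/OV Nx : N x by apply/(gXN (j - i)%N)/N0N.
by have := OM _ _ Ox Nx; rewrite invgM invgK mulVKg.
Qed.

Lemma cyclic_extension_power_finite_index N N0 g k : normaliser N g ->
  finite_index_in N N0 ->
  finite_index_in (cyclic_extension N g) (cyclic_extension N0 (g ^+ k.+1)).
Proof.
move=> gN [t tN]; exists [seq g ^+ i * c | i <- iota 0 k.+1, c <- t].
move=> _ [n Nn [z _ <-]].
pose r := `|(z %% k.+1)%Z|%N; pose q := (z %/ k.+1)%Z.
have rE : (r%:Z = z %% k.+1)%Z by rewrite gez0_abs ?modz_ge0.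
have zE : z = (r%:Z + q * k.+1%:Z)%R by rewrite rE addrC -divz_eq.
have [c ct Oc] := tN _ (normaliser_conj r gN Nn).
exists (g ^+ r * c).
  by apply: allpairs_f; rewrite // mem_iota -ltz_nat rE ltz_pmod.
exists (c^-1 * n ^ g ^+ r) => //; exists q => //.
by rewrite expgzX zE expgzD conjgE !gnorm.
Qed.

Definition virtually_poly_Z H := exists N,
  [/\ poly_Z N, N `<=` H & finite_index_in H N].

Lemma cyclic_extension_virtually_poly_Z N g : is_subgroup N -> normaliser N g ->
  finitely_generated N -> virtually_poly_Z N ->
  virtually_poly_Z (cyclic_extension N g).
Proof.
move=> sN gN fN [N0 [pN0 N0N iN0]]; have sNg := cyclic_extension_subgroup sN gN.
have sub_Ng := @sub_cyclic_extension _ N g.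
have [[k Ngk]|Ng] := pselect (exists k, N (g ^+ k.+1)).
  exists N0; split=> //; first exact: subset_trans sub_Ng.
  apply: finite_index_in_trans iN0.
  have [t tP] := cyclic_extension_power_finite_index k gN (finite_index_in_refl N).
  exists t => x /tP[c ct Nc]; exists c => //.
  exact: (cyclic_extension_min sN (@subset_refl _ N) Ngk).
have [k gkN0] := power_normalises sN (poly_Z_subgroup pN0) N0N fN iN0 gN.
exists (cyclic_extension N0 (g ^+ k.+1)); split.
- apply: poly_Z_extension => // l; rewrite -expgnA mulnS addSn => /N0N Ngl.
  by apply: Ng; exists (k + k.+1 * l)%N.
- apply: cyclic_extension_min => //; first exact: subset_trans sub_Ng.
  exact: (expgz_cyclic_extension g k.+1).
- exact: cyclic_extension_power_finite_index.
Qed.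

Lemma polycyclic_virtually_poly_Z H : polycyclic H -> virtually_poly_Z H.
Proof.
move: H; apply: polycyclic_ind => [|N g /polycyclic_finitely_generated fN sN gN].
  by exists [set 1]; split=> //; [exact: poly_Z_trivial|exact: finite_index_in_refl].
exact: cyclic_extension_virtually_poly_Z.
Qed.

Lemma polycyclic_by_finite_poly_Z : polycyclic_by_finite G ->
  exists2 H, poly_Z H & finite_index_in setT H.
Proof.
move=> [H [sH /polycyclic_virtually_poly_Z[N [pN _ iN]] fH]]; exists N => //.
exact: finite_index_in_trans (finite_index_setT sH fH) iN.
Qed.

End PolycyclicGroups.

Local Open Scope ring_scope.

Section Subspaces.
Variable K : fieldType.
Implicit Types V W : lmodType K.

(* For sets of configurations this unfolds to [vector_subspace]. *)
Definition is_subspace V (P : set V) : Prop :=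
  [/\ P 0, forall x y, P x -> P y -> P (x + y) & forall a x, P x -> P (a *: x)].

Definition sumset V (P Q : set V) : set V := [set x + y | x in P & y in Q].

Definition span V (I : choiceType) (F : I -> V) (D : set I) : set V :=
  [set v | exists2 s : seq (K * I), (forall p, p \in s -> D p.2) &
    v = \sum_(p <- s) p.1 *: F p.2].

Lemma subspaceN V (P : set V) x : is_subspace P -> P x -> P (- x).
Proof. by case=> _ _ PZ Px; rewrite -scaleN1r; exact: PZ. Qed.

Lemma subspaceB V (P : set V) x y : is_subspace P -> P x -> P y -> P (x - y).
Proof. by move=> sP Px Py; have [_ PD _] := sP; apply: PD => //; exact: subspaceN. Qed.

Lemma subspace_sum V (P : set V) (I : eqType) (r : seq I) (F : I -> V) :
  is_subspace P -> (forall i, i \in r -> P (F i)) -> P (\sum_(i <- r) F i).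
Proof. by case=> P0 PD _ PF; rewrite big_seq; elim/big_ind: _. Qed.

Lemma subspace_set0 V : is_subspace [set (0 : V)].
Proof. by split=> [//|x y -> ->|a x ->]; rewrite ?addr0 ?scaler0. Qed.

Lemma line_subspace V (v : V) : is_subspace (range ( *:%R^~ v)).
Proof.
split=> [|_ _ [a _ <-] [b _ <-]|b _ [a _ <-]].
- by exists 0; rewrite ?scale0r.
- by exists (a + b); rewrite ?scalerDl.
- by exists (b * a); rewrite ?scalerA.
Qed.

Lemma subspaceI V (P Q : set V) :
  is_subspace P -> is_subspace Q -> is_subspace (P `&` Q).
Proof.
move=> [P0 PD PZ] [Q0 QD QZ]; split=> // [x y [Px Qx] [Py Qy]|a x [Px Qx]].
  by split; [exact: PD|exact: QD].
by split; [exact: PZ|exact: QZ].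
Qed.

Lemma sumset_subspace V (P Q : set V) :
  is_subspace P -> is_subspace Q -> is_subspace (sumset P Q).
Proof.
move=> [P0 PD PZ] [Q0 QD QZ]; split.
- by exists 0 => //; exists 0; rewrite ?addr0.
- move=> _ _ [x Px [y Qy <-]] [x' Px' [y' Qy' <-]].
  by exists (x + x'); [exact: PD|exists (y + y'); [exact: QD|rewrite addrACA]].
- move=> a _ [x Px [y Qy <-]].
  by exists (a *: x); [exact: PZ|exists (a *: y); [exact: QZ|rewrite scalerDr]].
Qed.

Lemma sub_sumsetl V (P Q : set V) : Q 0 -> P `<=` sumset P Q.
Proof. by move=> Q0 x Px; exists x => //; exists 0; rewrite ?addr0. Qed.

Lemma sub_sumsetr V (P Q : set V) : P 0 -> Q `<=` sumset P Q.
Proof. by move=> P0 x Qx; exists 0 => //; exists x; rewrite ?add0r. Qed.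

Lemma sumset_min V (P Q M : set V) :
  is_subspace M -> P `<=` M -> Q `<=` M -> sumset P Q `<=` M.
Proof. by move=> [_ MD _] PM QM _ [x /PM Mx [y /QM My <-]]; exact: MD. Qed.

Lemma image_subspace V W (f : {linear V -> W}) (P : set V) :
  is_subspace P -> is_subspace (f @` P).
Proof.
move=> [P0 PD PZ]; split=> [|_ _ [x Px <-] [y Py <-]|a _ [x Px <-]].
- by exists 0; rewrite ?linear0.
- by exists (x + y); [exact: PD|rewrite linearD].
- by exists (a *: x); [exact: PZ|rewrite linearZ].
Qed.

Lemma preimage_subspace V W (f : {linear V -> W}) (P : set W) :
  is_subspace P -> is_subspace (f @^-1` P).
Proof.
move=> [P0 PD PZ]; split=> [|x y Px Py|a x Px] /=.
- by rewrite linear0.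
- by rewrite linearD; exact: PD.
- by rewrite linearZ; exact: PZ.
Qed.

Lemma directed_bigcup_subspace V (I : Type) (D : set I) (F : I -> set V) :
  D !=set0 -> (forall i, D i -> is_subspace (F i)) ->
  (forall i j, D i -> D j -> exists2 k, D k & F i `|` F j `<=` F k) ->
  is_subspace (\bigcup_(i in D) F i).
Proof.
move=> [i0 Di0] sF dirF; split.
- by exists i0 => //; case: (sF i0 Di0).
- move=> x y [i Di Fx] [j Dj Fy]; have [k Dk ijk] := dirF i j Di Dj.
  by exists k => //; have [_ FD _] := sF k Dk; apply: FD; apply: ijk; [left|right].
- by move=> a x [i Di Fx]; exists i => //; have [_ _ FZ] := sF i Di; exact: FZ.
Qed.

Section Span.
Variables (V : lmodType K) (I : choiceType) (F : I -> V) (D : set I).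

Lemma span_subspace : is_subspace (span F D).
Proof.
split.
- by exists [::] => //; rewrite big_nil.
- move=> _ _ [s sD ->] [t tD ->]; exists (s ++ t); last by rewrite big_cat.
  by move=> p; rewrite mem_cat => /orP[/sD|/tD].
- move=> a _ [s sD ->]; exists [seq (a * p.1, p.2) | p <- s].
    by move=> _ /mapP[p /sD Dp ->].
  by rewrite big_map scaler_sumr; apply: eq_bigr => p _; rewrite scalerA.
Qed.

Lemma mem_span i : D i -> span F D (F i).
Proof.
exists [:: (1, i)]; last by rewrite big_seq1 scale1r.
by move=> p; rewrite inE => /eqP ->.
Qed.

Lemma span_min (P : set V) :
  is_subspace P -> (forall i, D i -> P (F i)) -> span F D `<=` P.
Proof.
move=> sP DP _ [s sD ->]; apply: subspace_sum => // p /sD Dp.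
by have [_ _ PZ] := sP; exact/PZ/DP.
Qed.

Lemma span_uniq v : span F D v -> exists (r : seq I) (c : I -> K),
  [/\ uniq r, forall i, i \in r -> D i /\ c i != 0 & v = \sum_(i <- r) c i *: F i].
Proof.
move=> [s sD ->]; pose c i := \sum_(p <- s | p.2 == i) p.1.
exists [seq i <- undup (map snd s) | c i != 0], c; split.
- by rewrite filter_uniq ?undup_uniq.
- move=> i; rewrite mem_filter mem_undup => /andP[ci /mapP[p /sD Dp ei]].
  by rewrite ei in ci *.
rewrite big_filter [RHS]big_mkcond /=.
under [RHS]eq_bigr => i _.
  rewrite (_ : (if _ then _ else _) = c i *: F i); last first.
    by case: ifPn => // /negPn/eqP ->; rewrite scale0r.
  rewrite scaler_suml big_mkcond; over.
rewrite exchange_big /= big_seq [RHS]big_seq; apply: eq_bigr => p ps.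
rewrite -big_mkcond /=; under eq_bigl do rewrite eq_sym.
by rewrite -big_filter filter_pred1_uniq ?undup_uniq ?big_seq1 // mem_undup map_f.
Qed.

End Span.
End Subspaces.

Record linear_action (K : fieldType) (G : groupType) (V : lmodType K) := LinearAction {
  action_map :> G -> {linear V -> V};
  act1 : forall v, action_map 1%g v = v;
  actM : forall g h v, action_map (g * h)%g v = action_map g (action_map h v) }.

Section Noetherian.
Variables (K : fieldType) (G : groupType) (V : lmodType K) (rho : linear_action G V).
Implicit Types (H N : set G) (P Q W : set V) (g h : G) (v w : V).

Lemma actK g v : rho g^-1%g (rho g v) = v.
Proof. by rewrite -actM mulVg act1. Qed.

Lemma actKV g v : rho g (rho g^-1%g v) = v.
Proof. by rewrite -actM mulgV act1. Qed.

Definition is_submodule H P :=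
  is_subspace P /\ forall h v, H h -> P v -> P (rho h v).

Lemma submodule_set0 H : is_submodule H [set 0].
Proof. by split=> [|h v _ ->]; [exact: subspace_set0|exact: linear0]. Qed.

Lemma submodule0 H P : is_submodule H P -> P 0.
Proof. by case=> -[]. Qed.

Lemma submoduleI H P Q :
  is_submodule H P -> is_submodule H Q -> is_submodule H (P `&` Q).
Proof.
move=> [sP iP] [sQ iQ]; split=> [|h v Hh [Pv Qv]]; first exact: subspaceI.
by split; [exact: iP|exact: iQ].
Qed.

Lemma sumset_submodule H P Q :
  is_submodule H P -> is_submodule H Q -> is_submodule H (sumset P Q).
Proof.
move=> [sP iP] [sQ iQ]; split; first exact: sumset_subspace.
move=> h _ Hh [x Px [y Qy <-]].
by exists (rho h x); [exact: iP|exists (rho h y); [exact: iQ|rewrite linearD]].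
Qed.

Lemma image_submodule H (f : {linear V -> V}) P :
  (forall h v, f (rho h v) = rho h (f v)) -> is_submodule H P ->
  is_submodule H (f @` P).
Proof.
move=> f_rho [sP iP]; split; first exact: image_subspace.
by move=> h _ Hh [v Pv <-]; exists (rho h v); [exact: iP|exact: f_rho].
Qed.

Lemma span_orbit_submodule H v : is_subgroup H -> is_submodule H (span (rho^~ v) H).
Proof.
case=> _ HM _; split=> [|h _ Hh [s sH ->]]; first exact: span_subspace.
rewrite linear_sum; apply: subspace_sum => [|p ps]; first exact: span_subspace.
rewrite linearZ -actM; have [_ _ SZ] := span_subspace (rho^~ v) H.
by apply: SZ; apply: (@mem_span _ _ _ (rho^~ v)); apply: HM => //; exact: sH.
Qed.

Definition noetherian H W := is_submodule H W /\
  forall P : nat -> set V, (forall i, is_submodule H (P i)) ->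
    {homo P : i j / (i <= j)%N >-> i `<=` j} ->
    exists m, forall i, (m <= i)%N -> P i `&` W `<=` P m.

Lemma line_noetherian v : noetherian [set 1%g] (range ( *:%R^~ v)).
Proof.
split=> [|P mP homoP].
  split=> [|h _ -> [a _ <-]]; last by exists a; rewrite ?act1.
  exact: line_subspace.
have [[m Pmv]|nPv] := pselect (exists i, P i v).
  by exists m => i _ _ [_ [a _ <-]]; have [[_ _ PZ] _] := mP m; exact: PZ.
exists 0%N => i _ u [Piu [a _ eu]]; rewrite -eu in Piu *.
have [->|a0] := eqVneq a 0; first by rewrite scale0r; exact: submodule0 (mP 0%N).
case: nPv; exists i; have [[_ _ PZ] _] := mP i.
by rewrite -[v]scale1r -(mulVf a0) -scalerA; exact: PZ.
Qed.

Lemma sumset_noetherian H W W' :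
  noetherian H W -> noetherian H W' -> noetherian H (sumset W W').
Proof.
move=> [mW accW] [mW' accW']; split; first exact: sumset_submodule.
move=> P mP homoP; have [m stabW] := accW P mP homoP.
have [|i j ij|m' stabW'] := accW' (fun i => sumset (P i) W).
- by move=> i; exact: sumset_submodule.
- by move=> _ [x Px [w Ww <-]]; exists x; [exact: homoP Px|exists w].
have [[_ PD _] _] := mP (maxn m m'); have [sW _] := mW.
exists (maxn m m') => i; rewrite geq_max => /andP[mi m'i] v [Pv [w Ww [w' W'w' ev]]].
have [sPi _] := mP i; rewrite -ev in Pv *.
have [|p Pp [u Wu epu]] := stabW' i m'i w'.
  split=> //; exists (w + w') => //.
  by exists (- w); [exact: subspaceN|rewrite addrAC subrr add0r].
have Pwu : P m (w + u).
  apply: (stabW i mi); split; last by case: sW => _ WD _; exact: WD.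
  rewrite (_ : w + u = w + w' - p); last by rewrite -epu addrCA addrAC subrr add0r.
  by apply: subspaceB => //; exact: homoP Pp.
rewrite -epu addrCA; apply: PD; first exact: homoP (leq_maxr m m') _ Pp.
exact: homoP (leq_maxl m m') _ Pwu.
Qed.

Lemma noetherian_double_chain H W (L : nat -> nat -> set V) : noetherian H W ->
  (forall i n, is_submodule H (L i n)) ->
  (forall i j n m, (i <= j)%N -> (n <= m)%N -> L i n `<=` L j m) ->
  exists m, forall i n, (m <= i)%N -> L i n `&` W `<=` L m n.
Proof.
move=> [_ accW] mL homoL.
have [k diag_stab] : exists k, forall i, (k <= i)%N -> L i i `&` W `<=` L k k.
  by apply: (accW (fun i => L i i)) => // i j ij; exact: homoL.
have /choice[m row_stab] : forall n, exists m, forall i, (m <= i)%N ->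
    L i n `&` W `<=` L m n.
  by move=> n; apply: (accW (L^~ n)) => // i j ij; exact: homoL.
exists (maxn k (\max_(n < k) m n)) => i n; rewrite geq_max => /andP[ki mi] w [Lw Ww].
have [nk|kn] := ltnP n k.
  have mn : (m n <= \max_(n < k) m n)%N.
    exact: (leq_bigmax (F := fun n : 'I_k => m n) (Ordinal nk)).
  apply: (homoL (m n)) (row_stab n i (leq_trans mn mi) w _) => //.
  by rewrite leq_max mn orbT.
apply: (homoL k _ k n) (diag_stab (maxn i n) _ w _); rewrite ?leq_maxl //.
  by rewrite leq_max ki.
by split=> //; apply: homoL Lw; rewrite ?leq_maxl ?leq_maxr.
Qed.

Section HilbertBasis.
Variables (N : set G) (g : G) (W : set V).
Hypotheses (sN : is_subgroup N) (gN : normaliser N g) (nW : noetherian N W).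

Lemma preimage_normaliser_submodule h P :
  normaliser N h -> is_submodule N P -> is_submodule N (rho h @^-1` P).
Proof.
move=> hN [sP iP]; split; first exact: preimage_subspace.
move=> x v Nx Pv /=; rewrite -actM -(mulgVK h (h * x)%g) actM; apply: iP => //.
by apply/hN; rewrite conjgE !gnorm.
Qed.

Lemma cyclic_extension_invariant P : (forall h v, N h -> P v -> P (rho h v)) ->
  (forall v, P v -> P (rho g v)) -> (forall v, P v -> P (rho g^-1%g v)) ->
  forall h v, cyclic_extension N g h -> P v -> P (rho h v).
Proof.
move=> NP gP gVP h v Ngh; pose stab : set G := [set h | forall v, P v <-> P (rho h v)].
suff : cyclic_extension N g `<=` stab by move=> /(_ h Ngh v)[].
have [_ _ NV] := sN; apply: cyclic_extension_min => [|k Nk u|u].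
- split=> [u|k l sk sl u|k sk u]; first by rewrite act1.
    by rewrite actM -sk.
  by apply: iff_sym; have := sk (rho k^-1%g u); rewrite actKV.
- by split=> [|/(NP _ _ (NV _ Nk))]; [exact: NP|rewrite actK].
- by split=> [/gP//|/gVP]; rewrite actK.
Qed.

Fixpoint powers_below n : set V :=
  if n is m.+1 then sumset (rho (g ^+ m)%g @` W) (powers_below m) else [set 0].

Definition lead_coefs P n : set V := rho (g ^+ n)%g @^-1` sumset P (powers_below n).

Lemma normaliserX n : normaliser N (g ^+ n)%g.
Proof. exact: (subgroup_expgz n (normaliser_subgroup N)). Qed.

Lemma powers_below_submodule n : is_submodule N (powers_below n).
Proof.
elim: n => [|n IH] /=; first exact: submodule_set0.
apply: sumset_submodule => //.
have -> : rho (g ^+ n)%g @` W = rho (g ^- n)%g @^-1` W.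
  apply/seteqP; split=> [_ [w Ww <-]|v Wv] /=; first by rewrite actK.
  by exists (rho (g ^- n)%g v); rewrite ?actKV.
apply: preimage_normaliser_submodule; last by case: nW.
by have [_ _ NV] := normaliser_subgroup N; exact/NV/normaliserX.
Qed.

Lemma powers_below_homo : {homo powers_below : i j / (i <= j)%N >-> i `<=` j}.
Proof.
apply: homo_leq => [P|Q P R PQ QR|n] //; first exact: subset_trans QR.
have [mW _] := nW; apply: sub_sumsetr.
by exists 0; [exact: submodule0 mW|rewrite linear0].
Qed.

Lemma powers_below_shift n v : powers_below n v -> powers_below n.+1 (rho g v).
Proof.
elim: n v => [|n IH] v.
  by move=> ->; rewrite linear0; exact: submodule0 (powers_below_submodule 1).
move=> [_ [w Ww <-] [u Uu <-]]; exists (rho (g ^+ n.+1)%g w); first by exists w.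
by exists (rho g u); [exact: IH|rewrite linearD -actM expgS].
Qed.

Lemma lead_coefs_submodule P n : is_submodule N P -> is_submodule N (lead_coefs P n).
Proof.
move=> mP; apply: preimage_normaliser_submodule; first exact: normaliserX.
by apply: sumset_submodule => //; exact: powers_below_submodule.
Qed.

Lemma lead_coefs_homo P Q n m : (forall v, Q v -> Q (rho g v)) -> (n <= m)%N ->
  P `<=` Q -> lead_coefs P n `<=` lead_coefs Q m.
Proof.
move=> gQ nm PQ w [p /PQ Qp [u Uu epu]].
suff homoQ : {homo lead_coefs Q : i j / (i <= j)%N >-> i `<=` j}.
  by apply: (homoQ _ _ nm); exists p => //; exists u.
apply: homo_leq => [X|Y X Z XY YZ|k v [q Qq [u' Uu' ev]]] //.
  exact: subset_trans YZ.
exists (rho g q); first exact: gQ.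
by exists (rho g u'); [exact: powers_below_shift|rewrite -linearD ev -actM expgS].
Qed.

(* Induction on the number of powers: a leading coefficient shared with [P]
   lets an element of [P] lower the degree. *)
Lemma lead_coefs_determine P Q : is_subspace P -> is_subspace Q -> P `<=` Q ->
  (forall n, lead_coefs Q n `&` W `<=` lead_coefs P n) ->
  forall n, Q `&` powers_below n `<=` P.
Proof.
move=> sP sQ PQ leadQP; have [P0 PD _] := sP.
have sU n : is_subspace (powers_below n) by case: (powers_below_submodule n).
elim=> [|n IH] v [Qv]; first by move=> ->.
move=> [_ [w Ww <-] [u Uu ev]].
have [|p Pp [u' Uu' ep]] := leadQP n w.
  split=> //; exists v => //; exists (- u); last by rewrite -ev addrK.
  exact: subspaceN.
rewrite -(subrK p v) addrC; apply: PD => //; apply: IH; split.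
  by apply: subspaceB => //; exact: PQ.
rewrite -ev -ep addrAC (addrAC p) subrr add0r.
by case: (sU n) => _ UD _; exact: UD.
Qed.

(* The [n]-th set is spanned by the [rho (g ^ k) @` W] with [- n <= k < n]. *)
Definition cyclic_span : set V :=
  \bigcup_n (rho (g ^+ n)%g @^-1` powers_below n.*2).

Lemma sub_cyclic_span : W `<=` cyclic_span.
Proof.
move=> w Ww; exists 1%N => //; exists (rho (g ^+ 1)%g w); first by exists w.
by exists 0; rewrite ?addr0 //; exact: submodule0 (powers_below_submodule 1).
Qed.

Lemma cyclic_span_homo :
  {homo (fun n => rho (g ^+ n)%g @^-1` powers_below n.*2) :
    i j / (i <= j)%N >-> i `<=` j}.
Proof.
apply: homo_leq => [P|Q P R PQ QR|n v Uv] //; first exact: subset_trans QR.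
suff: powers_below n.+1.*2 (rho (g * g ^+ n)%g v) by rewrite -expgS.
by rewrite actM; apply: powers_below_homo (powers_below_shift Uv).
Qed.

Lemma cyclic_span_submodule : is_submodule (cyclic_extension N g) cyclic_span.
Proof.
have sE : is_subspace cyclic_span.
  apply: directed_bigcup_subspace => [|n _|i j _ _]; first by exists 0%N.
    by apply: preimage_subspace; case: (powers_below_submodule n.*2).
  exists (maxn i j) => //.
  by rewrite subUset; split; apply: cyclic_span_homo; rewrite ?leq_maxl ?leq_maxr.
split=> // h v; apply: cyclic_extension_invariant => {h v} [h v Nh [n _ Uv]||].
- exists n => //.
  have := preimage_normaliser_submodule (normaliserX n) (powers_below_submodule n.*2).
  by case=> _; exact.
- move=> v [n _ Uv]; exists n.+1 => //.
  suff: powers_below n.+1.*2 (rho (g ^+ n.+1 * g)%g v) by rewrite actM.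
  by rewrite -expgSr !expgS !actM; do 2!apply: powers_below_shift.
- move=> v [n _ Uv]; exists n.+1 => //.
  suff: powers_below n.+1.*2 (rho (g ^+ n * g)%g (rho g^-1%g v)) by rewrite -expgSr.
  by rewrite actM actKV; apply: powers_below_homo Uv; rewrite leq_double.
Qed.

Lemma cyclic_span_noetherian : noetherian (cyclic_extension N g) cyclic_span.
Proof.
split; first exact: cyclic_span_submodule.
move=> P mP homoP.
have expgzP i z v : P i v -> P i (rho (expgz g z) v).
  by have [_ iP] := mP i; apply: iP; exact: expgz_cyclic_extension.
have [m stab] : exists m, forall i n, (m <= i)%N ->
    lead_coefs (P i) n `&` W `<=` lead_coefs (P m) n.
  apply: (noetherian_double_chain nW) => [i n|i j n m ij nm].
    have [sPi iPi] := mP i; apply: lead_coefs_submodule; split=> // h v Nh.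
    by apply: iPi; exact: sub_cyclic_extension.
  by apply: lead_coefs_homo => //; [exact: (expgzP j 1)|exact: homoP].
exists m => i mi v [Pv [n _ Uv]]; have [[sPm _] [sPi _]] := (mP m, mP i).
rewrite -(actK (g ^+ n)%g v) -[(g ^+ n)%g]/(expgz g n) -expgzN; apply: (expgzP).
apply: (lead_coefs_determine sPm sPi (homoP _ _ mi)) => [k|]; first exact: stab.
by split; [exact: (expgzP i n)|exact: Uv].
Qed.

End HilbertBasis.

(* Hall's theorem. *)
Lemma poly_Z_noetherian H v : poly_Z H -> exists2 W, noetherian H W & W v.
Proof.
elim=> [|N g /poly_Z_subgroup sN [W nW Wv] gN _].
  by exists (range ( *:%R^~ v)); [exact: line_noetherian|exists 1; rewrite ?scale1r].
by exists (cyclic_span g W); [exact: cyclic_span_noetherian|exact: sub_cyclic_span].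
Qed.

Lemma finitely_generated_noetherian H (s : seq V) : poly_Z H ->
  exists2 W, noetherian H W & forall v, v \in s -> W v.
Proof.
move=> pH; elim: s => [|v s [W nW sW]].
  by have [W nW _] := poly_Z_noetherian 0 pH; exists W.
have [W' nW' W'v] := poly_Z_noetherian v pH.
have [[mW _] [mW' _]] := (nW, nW').
exists (sumset W' W); first exact: sumset_noetherian.
move=> u; rewrite inE => /predU1P[->|/sW Wu].
  by apply: sub_sumsetl => //; exact: submodule0 mW.
by apply: sub_sumsetr => //; exact: submodule0 mW'.
Qed.

Lemma equivariant_family_noetherian H (J : finType) (b : G -> J -> V) :
  poly_Z H -> finite_index_in setT H -> (forall g i, b g i = rho g (b 1%g i)) ->
  exists2 W, noetherian H W &
    forall (F : seq G) (c : G -> J -> K), W (\sum_(g <- F) \sum_i c g i *: b g i).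
Proof.
move=> pH [t tH] b_rho; have [W nW tW] := finitely_generated_noetherian
  [seq b x^-1%g i | x <- t, i <- enum J] pH.
exists W => // F c; have [[sW iW] _] := nW; have [_ _ WZ] := sW.
apply: subspace_sum => // g _; apply: subspace_sum => // i _; apply: WZ.
have [x xt Hxg] := tH g^-1%g I; have [_ _ HV] := poly_Z_subgroup pH.
have -> : b g i = rho (x^-1 * g^-1)^-1%g (b x^-1%g i).
  by rewrite [in LHS]b_rho [in RHS]b_rho -actM !gnorm.
apply: iW; first exact: HV.
by apply: tW; apply: allpairs_f; rewrite ?mem_enum.
Qed.

End Noetherian.

Section VanishingOnImage.
Variables (K : fieldType) (G : groupType) (V : lmodType K) (rho : linear_action G V).
Variables (H : set G) (f : {linear V -> K^o}) (m : V) (B : seq G).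
Hypotheses (sH : is_subgroup H) (upH : has_unique_products H).
Hypothesis fB : forall h, H h -> f (rho h m) != 0 -> h \in B.

(* [v |-> \sum_h f (rho h v) h^-1] is K[H]-linear and K[H] has no zero divisors,
   so that it is injective on the module spanned by [m]. *)
Lemma span_orbit_inj v : f m != 0 -> span (rho^~ m) H v ->
  (forall h, H h -> f (rho h v) = 0) -> v = 0.
Proof.
move=> fm /span_uniq[r [c [ur rH ->]]] fv0; have [H1 HM HV] := sH.
have [->|r0] := eqVneq r [::]; first by rewrite big_nil.
pose t := [seq k <- B | (f (rho k m) != 0) && `[< H k >]].
have mem_t k : H k -> f (rho k m) != 0 -> k \in t.
  by move=> Hk fk; rewrite mem_filter fk fB // andbT; exact/asboolP.
have t1 : 1%g \in t by rewrite mem_t ?act1.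
have [||||k [_ [kt /mapP[h hr ->] uniq_kh]]] := @upH t [seq h^-1%g | h <- r].
- by apply: contraTneq t1 => ->.
- by rewrite -size_eq0 size_map size_eq0.
- by move=> k; rewrite mem_filter => /andP[/andP[_ /asboolP]].
- by move=> _ /mapP[h hr ->]; apply: HV; have [] := rH h hr.
have [[Hh ch] Hk] : (H h /\ c h != 0) /\ H k.
  by split; [exact: rH|move: kt; rewrite mem_filter => /andP[/andP[_ /asboolP]]].
have fk : f (rho k m) != 0 by move: kt; rewrite mem_filter => /andP[/andP[]].
have Hkh : H (k * h^-1)%g by exact/HM/HV.
have /eqP := fv0 _ Hkh.
rewrite !linear_sum (bigD1_seq h) //= big_seq_cond big1 => [|h'].
  by rewrite addr0 !linearZ -actM mulgVK mulf_eq0 (negPf ch) (negPf fk).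
case/andP=> h'r h'h; rewrite !linearZ -actM /=; apply/eqP.
apply: contraNT h'h => /negPf fh'; have [Hh' _] := rH h' h'r.
have kh't : (k * h^-1 * h')%g \in t.
  apply: mem_t; first exact: HM.
  by apply: contraFN fh' => /eqP ->; rewrite scaler0.
have [|_ /invg_inj ->//] := uniq_kh _ _ kh't (map_f _ h'r).
by rewrite mulgK.
Qed.

Variables (W M N : set V) (Phi : {linear V -> V}).
Hypotheses (nW : noetherian rho H W) (MW : M `<=` W) (Mm : M m).
Hypotheses (mM : is_submodule rho H M) (mN : is_submodule rho H N) (NM : N `<=` M).
Hypotheses (Phi_rho : forall h v, Phi (rho h v) = rho h (Phi v)).
Hypotheses (PhiM : forall v, M v -> M (Phi v)).
Hypotheses (Phi_inj_mod : forall v, M v -> N (Phi v) -> N v).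
Hypotheses (fN : forall v, N v -> f v = 0) (fPhi : forall v, M v -> f (Phi v) = 0).

Fixpoint image_tower (k : nat) : set V :=
  if k is l.+1 then sumset N (sumset (span (rho^~ m) H) (Phi @` image_tower l)) else N.

Lemma image_tower_submodule k : is_submodule rho H (image_tower k).
Proof.
elim: k => [|k IH] //=; apply: sumset_submodule => //; apply: sumset_submodule.
  exact: span_orbit_submodule.
exact: image_submodule.
Qed.

Lemma image_tower_homo : {homo image_tower : i j / (i <= j)%N >-> i `<=` j}.
Proof.
apply: homo_leq => [P|Q P R PQ QR|k] //; first exact: subset_trans QR.
have tower0 l : image_tower l 0 by exact: submodule0 (image_tower_submodule l).
have [S0 _ _] := span_subspace (rho^~ m) H.
elim: k => [|k IH] /=; last first.
  move=> _ [n Nn [_ [x Sx [_ [y Py <-] <-]] <-]]; exists n => //.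
  exists (x + Phi y) => //; exists x => //; exists (Phi y) => //.
  by exists y => //; exact: IH.
apply: sub_sumsetl; exists 0 => //; exists 0; rewrite ?addr0 //.
by exists 0; [exact: (tower0 0%N)|rewrite linear0].
Qed.

Lemma image_tower_sub k : image_tower k `<=` M.
Proof.
have [sM iM] := mM; elim: k => [|k IH] //=.
apply: sumset_min => //; apply: sumset_min => // [|_ [v /IH Mv <-]]; last exact: PhiM.
by apply: span_min => // h Hh; exact: iM.
Qed.

Lemma iter_in_image_tower k : image_tower k.+1 (iter k Phi m).
Proof.
have tower0 l : image_tower l 0 by exact: submodule0 (image_tower_submodule l).
have [H1 _ _] := sH; have [S0 _ _] := span_subspace (rho^~ m) H.
elim: k => [|k IH].
  apply: sub_sumsetr; first exact: (tower0 0%N).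
  apply: sub_sumsetl; first by exists 0; [exact: (tower0 0%N)|rewrite linear0].
  by have := mem_span (rho^~ m) H1; rewrite act1.
apply: sub_sumsetr; first exact: (tower0 0%N).
by apply: sub_sumsetr => //; exists (iter k Phi m).
Qed.

Lemma iter_notin_image_tower k : f m != 0 -> ~ image_tower k (iter k Phi m).
Proof.
move=> fm; have [[sM iM] [sN iN]] := (mM, mN).
have MX l : M (iter l Phi m) by elim: l => //= l; exact: PhiM.
elim: k => [/fN/eqP|k IH [n Nn [_ [x Sx [_ [y Py <-] <-]] e]]].
  by rewrite (negPf fm).
have My : M y by exact: image_tower_sub Py.
have Mx : M x by apply: span_min Sx => // h Hh; exact: iM.
have x0 : x = 0.
  apply: (span_orbit_inj fm Sx) => h Hh.
  have := fPhi (iM _ _ Hh (MX k)); rewrite Phi_rho -[Phi _]e !linearD /=.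
  by rewrite -Phi_rho fPhi ?(fN (iN _ _ Hh Nn)) ?add0r ?addr0 //; exact: iM.
apply: IH; rewrite -(subrK y (iter k Phi m)).
have [[_ PD _] _] := image_tower_submodule k; apply: PD => //.
apply: (@image_tower_homo 0 k isT _ _); apply: Phi_inj_mod; first exact: subspaceB.
by rewrite linearB /= -[Phi (iter k Phi m)]e x0 add0r addrK.
Qed.

(* If [f m] is nonzero, the sum of the modules [Phi^i (K[H] m)] is direct
   modulo [N], which contradicts the ascending chain condition. *)
Lemma vanishing_on_image_eq0 : f m = 0.
Proof.
apply/eqP; apply/negPn/negP => fm; have [_ acc] := nW.
have [k stab] := acc _ image_tower_submodule image_tower_homo.
apply: (iter_notin_image_tower (k := k) fm); apply: (stab k.+1 (leqnSn k)).
split; first exact: iter_in_image_tower.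
by apply: MW; elim: k {stab} => //= k; exact: PhiM.
Qed.

End VanishingOnImage.

Section SeparatingFunctional.
Variables (K : fieldType) (V : lmodType K).
Implicit Types P Q M : set V.

Lemma maximal_subspace_avoiding P x : is_subspace P -> ~ P x -> exists M,
  [/\ is_subspace M, P `<=` M, ~ M x &
      forall Q, is_subspace Q -> M `<=` Q -> ~ Q x -> Q `<=` M].
Proof.
move=> sP nPx.
have [F sF totF|X [[sX nXx] maxX]] :=
    @Zorn_bigcup _ [set X | is_subspace (X `|` P) /\ ~ (X `|` P) x].
  have [->|F0] := eqVneq F set0; first by rewrite bigcup_set0; split; rewrite set0U.
  have {}F0 : F !=set0 by exact/set0P.
  split; rewrite -bigcupUl //; last by move=> [X /sF[]].
  apply: directed_bigcup_subspace => // [X /sF[]//|X Y FX FY].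
  by have [XY|YX] := totF X Y FX FY; [exists Y|exists X] => //;
    rewrite subUset; split=> //; exact: setSU.
exists (X `|` P); split=> // Q sQ XPQ nQx q Qq.
have QP : Q `|` P = Q by apply/setUidPl => p Pp; apply: XPQ; right.
apply: contrapT => nXq; apply: (maxX Q); last by split; rewrite QP.
by split=> [z Xz|QX]; [apply: XPQ; left|apply: nXq; left; exact: QX].
Qed.

Lemma separating_functional P x : is_subspace P -> ~ P x ->
  exists2 f : {linear V -> K^o}, (forall v, P v -> f v = 0) & f x = 1.
Proof.
move=> sP /(maximal_subspace_avoiding sP)[M [sM PM nMx maxM]].
have [M0 MD MZ] := sM.
have coord_uniq v a b : M (v - a *: x) -> M (v - b *: x) -> a = b.
  move=> Ma Mb; apply/eqP; rewrite -subr_eq0; apply: contra_notT nMx => ab0.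
  have := subspaceB sM Mb Ma; rewrite opprB addrC addrA subrK -scalerBl.
  by move/(MZ (a - b)^-1); rewrite scalerA mulVf // scale1r.
have /choice[f fP] : forall v, exists a, M (v - a *: x).
  move=> v; apply: contrapT => nv.
  pose Q := sumset M (range ( *:%R^~ v)).
  have sQ : is_subspace Q.
    by apply: sumset_subspace => //; exact: line_subspace.
  have MQ : M `<=` Q by apply: sub_sumsetl; exists 0; rewrite ?scale0r.
  have nQx : ~ Q x.
    move=> [u Mu [_ [a _ <-] ex]]; apply: nv.
    have [a0|a0] := eqVneq a 0; first by rewrite -ex a0 scale0r addr0 in nMx.
    exists a^-1; rewrite -ex scalerDr scalerA mulVf // scale1r opprD addrCA subrr addr0.
    by rewrite -scaleNr; exact: MZ.
  apply: nv; exists 0; rewrite scale0r subr0; apply: (maxM Q) => //.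
  by exists 0 => //; exists v; rewrite ?add0r //; exists 1; rewrite ?scale1r.
have f_linear : linear (f : V -> K^o).
  move=> a u v; apply: (coord_uniq (a *: u + v)); first exact: fP.
  rewrite scalerDl opprD addrACA -scalerA -scalerBr; apply: MD => //.
  exact: MZ.
pose fL : {linear V -> K^o} := HB.pack (f : V -> K^o)
  (GRing.isLinear.Build K V K^o _ (f : V -> K^o) f_linear).
exists fL => [v /PM Mv|]; apply: (coord_uniq _ _ _ (fP _)).
  by rewrite scale0r subr0.
by rewrite scale1r subrr.
Qed.

End SeparatingFunctional.

Lemma linear_extension (K : fieldType) (V : lmodType K) (R : set (V * K^o)) :
  is_subspace R -> ~ R (0, 1) ->
  exists psi : {linear V -> K^o}, forall v a, R (v, a) -> psi v = a.
Proof.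
move=> sR /(separating_functional sR)[f fR f1].
have psi_linear : linear (fun v => - f (v, 0) : K^o).
  move=> a u v; have -> : (a *: u + v, 0) = a *: (u, 0) + (v, 0) :> V * K^o.
    by congr (_, _); rewrite /= scaler0 addr0.
  by rewrite linearP opprD scalerN.
pose psi : {linear V -> K^o} := HB.pack (fun v => - f (v, 0) : K^o)
  (GRing.isLinear.Build K V K^o *:%R (fun v => - f (v, 0) : K^o) psi_linear).
exists psi => v a /fR; rewrite /=.
have -> : (v, a) = (v, 0) + a *: (0, 1) :> V * K^o.
  by congr (_, _); rewrite /= ?scaler0 ?addr0 // add0r [RHS]mulr1.
rewrite linearD linearZ f1 => /eqP; rewrite addr_eq0 => /eqP ->.
by rewrite opprK [LHS]mulr1.
Qed.

Section Prodiscrete.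
Variables (K : fieldType) (A : vectType K) (G : groupType).
Implicit Types (x y z : G -> A) (F : seq G).

Definition agree F x : set (G -> A) := [set z : G -> A | {in F, z =1 x}].

Lemma prodiscrete_nbhsP (x : {ptws G -> discrete_topology A}) (B : set (G -> A)) :
  nbhs x B <-> exists F, agree F x `<=` B.
Proof.
split=> [|[F FB]].
  pose cyl : set_system (G -> A) := filter_from setT (agree^~ x).
  have fcyl : Filter cyl.
    apply: filter_from_filter; first by exists [::].
    move=> F F' _ _; exists (F ++ F') => // z zFF'.
    by split=> g gF; apply: zFF'; rewrite mem_cat gF ?orbT.
  have cvgx : {ptws, cyl --> (x : {ptws G -> discrete_topology A})}.
    apply/cvg_sup => g U [V] [[W] oW <-] Wx VU.
    apply: filterS VU _; exists [:: g] => // z /(_ g (mem_head _ _)) zg.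
    by rewrite /= zg.
  by move=> /cvgx[F _ FB]; exists F.
have fx : Filter (nbhs x).
  exact: (@nbhs_filter {ptws G -> discrete_topology A}).
apply: filterS FB _; elim: F => [|g F IH].
  by rewrite (_ : agree [::] x = setT) ?eqEsubset //; exact: filterT.
have pg : nbhs x [set z : {ptws G -> discrete_topology A} | z g = x g].
  have := @proj_continuous G (fun=> discrete_topology A) g x [set x g].
  by apply; exact: discrete_set1.
by apply: filterS (filterI pg IH) => z [zg zF] h; rewrite inE => /predU1P[->//|/zF].
Qed.

Lemma prodiscrete_closedP (Sigma : set (G -> A)) : prodiscrete_closed Sigma <->
  forall x, (forall F, exists2 z, Sigma z & agree F x z) -> Sigma x.
Proof.
split=> [cS x xS|xS x clx].
  apply: cS => B /prodiscrete_nbhsP[F FB].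
  by have [z Sz Fz] := xS F; exists z; split => //; exact: FB.
apply: xS => F; have [|z [Sz Fz]] := clx (agree F x); last by exists z.
by apply/prodiscrete_nbhsP; exists F.
Qed.

End Prodiscrete.

Definition precomp (X Y U : Type) (u : X -> Y) (f : Y -> U) : X -> U := f \o u.

HB.instance Definition _ (K : fieldType) (X Y : Type) (U : lmodType K) (u : X -> Y) :=
  GRing.isLinear.Build K (Y -> U) (X -> U) *:%R (@precomp X Y U u) (fun _ _ _ => erefl).

Definition eval_at (K : fieldType) (X : Type) (x : X) (f : X -> K^o) : K^o := f x.

HB.instance Definition _ (K : fieldType) (X : Type) (x : X) :=
  GRing.isLinear.Build K (X -> K^o) K^o *:%R (@eval_at K X x) (fun _ _ _ => erefl).

HB.instance Definition _ (K : fieldType) (A : vectType K) (G : groupType) (g : G) :=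
  GRing.isLinear.Build K (G -> A) (G -> A) *:%R (@shift K A G g) (fun _ _ _ => erefl).

Section LocalFunctionals.
Variables (K : fieldType) (A : vectType K) (G : groupType).
Local Notation config := (G -> A).
Local Notation dual := (config -> K^o).
Local Notation index := 'I_(\dim {:A}).
Local Notation basisA := (vbasis {:A}).
Implicit Types (x y z : config) (n : dual) (F : seq G) (g h : G) (i : index).
Implicit Types Sigma : set config.

Definition finitely_determined (U : Type) (f : config -> U) :=
  exists F, forall x y, agree F x y -> f x = f y.

Definition local_functional : set dual :=
  [set n : dual | exists2 f : {linear config -> K^o}, n = f & finitely_determined f].

Definition finitely_supported : set config :=
  [set x | exists F, forall g, g \notin F -> x g = 0].

Definition evaluation g i : dual := fun x => coord basisA i (x g).

HB.instance Definition _ g i := GRing.isLinear.Build K config K^o _ (evaluation g i)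
  (fun a x y => linearP (coord basisA i) a (x g) (y g)).

Definition point g i : config := fun h => if h == g then basisA`_i else 0.

Definition restriction F x : config :=
  \sum_(g <- F) \sum_i evaluation g i x *: point g i.

Lemma coordA (a : A) : a = \sum_i coord basisA i a *: basisA`_i.
Proof. exact/coord_vbasis/memvf. Qed.

Lemma coord_inj (a b : A) : (forall i, coord basisA i a = coord basisA i b) -> a = b.
Proof. by move=> e; rewrite [a]coordA [b]coordA; apply: eq_bigr => i _; rewrite e. Qed.

Lemma restrictionE F x h : uniq F -> restriction F x h = if h \in F then x h else 0.
Proof.
move=> uF; rewrite /restriction fct_sumE.
have pointE g : (\sum_i evaluation g i x *: point g i) h = if g == h then x h else 0.
  rewrite fct_sumE; have [->|gh] := eqVneq g h.
    rewrite [RHS]coordA; apply: eq_bigr => i _.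
    by rewrite scalrfctE /point eqxx.
  by rewrite big1 // => i _; rewrite scalrfctE /point eq_sym (negPf gh) scaler0.
under eq_bigr do rewrite pointE.
rewrite -big_mkcond -big_filter; case: ifP => hF.
  by rewrite filter_pred1_uniq // big_seq1.
rewrite big_seq big1 // => g; rewrite mem_filter => /andP[/eqP ->].
by rewrite hF.
Qed.

Lemma local_functionalE n : local_functional n ->
  exists F, n = \sum_(g <- F) \sum_i n (point g i) *: evaluation g i.
Proof.
move=> [f -> [F fF]]; exists (undup F); apply/funext => x; rewrite fct_sumE.
rewrite (fF x (restriction (undup F) x)) => [|g gF]; last first.
  by rewrite restrictionE ?undup_uniq // mem_undup gF.
rewrite linear_sum; apply: eq_bigr => g _; rewrite linear_sum fct_sumE.
by apply: eq_bigr => i _; rewrite linearZ scalrfctE /= [LHS]mulrC.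
Qed.

Lemma evaluation_local g i : local_functional (evaluation g i).
Proof.
exists (evaluation g i : {linear config -> K^o}) => //.
by exists [:: g] => x y xy; rewrite /= /evaluation xy ?mem_head.
Qed.

Lemma functional_representation (psi : {linear dual -> K^o}) :
  exists x, forall n, local_functional n -> n x = psi n.
Proof.
exists (fun g => \sum_i psi (evaluation g i) *: basisA`_i) => n.
move=> /local_functionalE[F ->].
rewrite linear_sum fct_sumE; apply: eq_bigr => g _.
rewrite linear_sum fct_sumE; apply: eq_bigr => i _; rewrite linearZ scalrfctE /=.
by rewrite /evaluation coord_sum_free ?(basis_free (vbasisP _)).
Qed.

Lemma shift1 x : shift 1%g x = x.
Proof. by apply/funext => g; rewrite /shift invg1 mul1g. Qed.

Lemma shiftM g h x : shift (g * h)%g x = shift g (shift h x).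
Proof. by apply/funext => k; rewrite /shift invgM mulgA. Qed.

Definition shift_action : linear_action G config :=
  @LinearAction K G config (fun g => @shift K A G g) shift1 shiftM.

Lemma precomp_shift1 n : precomp (shift 1^-1%g) n = n.
Proof. by apply/funext => x; rewrite /precomp /= invg1 shift1. Qed.

Lemma precomp_shiftM g h n : precomp (shift (g * h)^-1%g) n =
  precomp (shift g^-1%g) (precomp (shift h^-1%g) n).
Proof. by apply/funext => x; rewrite /precomp /= invgM shiftM. Qed.

Definition dual_action : linear_action G dual :=
  @LinearAction K G dual (fun g => @precomp config config K^o (shift g^-1%g))
    precomp_shift1 precomp_shiftM.

Section NoetherianModules.
Variable H : set G.
Hypotheses (pH : poly_Z H) (iH : finite_index_in setT H).

Lemma finitely_supported_noetherian :
  exists2 W, noetherian shift_action H W & finitely_supported `<=` W.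
Proof.
have [g i|W nW sumW] := equivariant_family_noetherian (rho := shift_action)
  (b := point) pH iH.
  by apply/funext => k; rewrite /= /shift /point -(inj_eq (@mulgI _ g^-1%g)) mulVg.
exists W => // x [F xF]; have -> : x = restriction (undup F) x.
  apply/funext => h; rewrite restrictionE ?undup_uniq // mem_undup.
  by case: ifPn => // /xF.
exact: sumW.
Qed.

Lemma local_functional_noetherian :
  exists2 W, noetherian dual_action H W & local_functional `<=` W.
Proof.
have [g i|W nW sumW] := equivariant_family_noetherian (rho := dual_action)
  (b := evaluation) pH iH.
  by apply/funext => x; rewrite /= /precomp /evaluation /= /shift invgK mulg1.
by exists W => // n /local_functionalE[F ->]; exact: sumW.
Qed.

End NoetherianModules.

Lemma finitely_supported_submodule H : is_submodule shift_action H finitely_supported.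
Proof.
split; first split.
- by exists [::].
- move=> x y [F xF] [F' yF']; exists (F ++ F') => g.
  by rewrite mem_cat negb_or => /andP[/xF xg /yF' yg]; rewrite addrfctE xg yg addr0.
- by move=> a x [F xF]; exists F => g /xF xg; rewrite scalrfctE xg scaler0.
move=> h x _ [F xF]; exists [seq (h * g)%g | g <- F] => g gF; apply: xF.
by apply: contra gF => gF; rewrite -(mulVKg h g) map_f.
Qed.

Lemma local_functional_submodule H : is_submodule dual_action H local_functional.
Proof.
split; first split.
- by exists (\0 : {linear config -> K^o}) => //; exists [::].
- move=> _ _ [f -> [F fF]] [f' -> [F' f'F']].
  exists (f \+ f' : {linear config -> K^o}) => //; exists (F ++ F') => x y xy /=.
  by rewrite (fF x y) ?(f'F' x y) // => g gF; apply: xy; rewrite mem_cat gF ?orbT.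
- move=> a _ [f -> [F fF]]; exists (a \*: f : {linear config -> K^o}) => //.
  by exists F => x y /fF /= ->.
move=> h _ _ [f -> [F fF]]; exists (f \o shift h^-1%g : {linear config -> K^o}) => //.
exists [seq (h * g)%g | g <- F] => x y xy /=; apply: fF => g gF.
by rewrite /shift invgK xy ?map_f.
Qed.

Definition annihilator Sigma : set dual :=
  local_functional `&` [set n | forall x, Sigma x -> n x = 0].

Lemma annihilator_subspace Sigma : is_subspace (annihilator Sigma).
Proof.
have [sL _] := local_functional_submodule set0; apply: subspaceI => //.
split=> [//|m n mS nS x Sx|a n nS x Sx]; first by rewrite addrfctE mS ?nS ?addr0.
by rewrite scalrfctE nS ?scaler0.
Qed.

Lemma annihilator_submodule H Sigma :
  shift_invariant Sigma -> is_submodule dual_action H (annihilator Sigma).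
Proof.
move=> iS; have [_ iL] := local_functional_submodule H.
split=> [|h n Hh [ln nS]]; first exact: annihilator_subspace.
by split; [exact: iL|move=> x Sx; apply: nS; exact: iS].
Qed.

Lemma annihilatorS Sigma Sigma' :
  Sigma `<=` Sigma' -> annihilator Sigma' `<=` annihilator Sigma.
Proof. by move=> SS' n [ln nS']; split=> // x /SS'/nS'. Qed.

Lemma mem_biannihilator Sigma x : prodiscrete_closed Sigma -> is_subspace Sigma ->
  (forall n, annihilator Sigma n -> n x = 0) -> Sigma x.
Proof.
move=> /prodiscrete_closedP cS sS xS; apply: cS => F; apply: contrapT => nz.
have sF : is_subspace (agree F (0 : config)).
  split=> [//|y z y0 z0 g gF|a y y0 g gF]; first by rewrite addrfctE y0 ?z0 ?addr0.
  by rewrite scalrfctE y0 ?scaler0.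
have [S0 _ _] := sS; have [F0 _ _] := sF.
have [[z Sz [w w0 ex]]|f fS0 fx] :=
    separating_functional (sumset_subspace sS sF) (x := x).
  by apply: nz; exists z => // g gF; rewrite -ex addrfctE w0 ?addr0.
suff: f x = 0 by rewrite fx => /eqP; rewrite oner_eq0.
apply: xS; split; last by move=> z Sz; apply: fS0; exact: sub_sumsetl.
exists f => //; exists F => y z yz; apply/eqP; rewrite -subr_eq0 -linearB fS0 //.
by apply: sub_sumsetr => // g gF; rewrite -[LHS]/(y g - z g) yz // subrr.
Qed.

Lemma solutions_subspace x : is_subspace [set p : dual * K^o | p.1 x = p.2].
Proof. by split=> [//|p q /= <- <-|a p /= <-]. Qed.

(* Linear compactness of the closed subspaces of [G -> A]. *)
Lemma linear_system_solvable Sigma (J : choiceType) (e : J -> dual) (b : J -> K^o)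
    (D : set J) :
  prodiscrete_closed Sigma -> is_subspace Sigma ->
  (forall j, D j -> local_functional (e j)) ->
  (forall s : seq J, (forall j, j \in s -> D j) ->
    exists2 x, Sigma x & forall j, j \in s -> e j x = b j) ->
  exists2 x, Sigma x & forall j, D j -> e j x = b j.
Proof.
move=> cS sS local_e solve; pose E j : dual * K^o := (e j, b j).
pose P : set (dual * K^o) :=
  sumset (span E D) [set p | annihilator Sigma p.1 /\ p.2 = 0].
have [N0 ND NZ] := annihilator_subspace Sigma; have [E0 _ _] := span_subspace E D.
have sP : is_subspace P.
  apply: sumset_subspace; first exact: span_subspace.
  split=> [//|p q [pS p0] [qS q0]|a p [pS p0]] /=.
    by split; [exact: ND|rewrite p0 q0 addr0].
  by split; [exact: NZ|rewrite p0 scaler0].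
have nP1 : ~ P (0, 1).
  move=> [_ [s sD ->] [q [[_ qS] q0] e01]].
  have [|x Sx xs] := solve (map snd s); first by move=> _ /mapP[p /sD Dp ->].
  have sQ := solutions_subspace x; have [_ QD QZ] := sQ.
  suff: [set p : dual * K^o | p.1 x = p.2] (0, 1).
    by move=> /= /esym/eqP; rewrite oner_eq0.
  rewrite -e01; apply: QD; last by rewrite /= qS ?q0.
  by apply: subspace_sum => // p ps; apply: QZ; rewrite /= xs ?map_f.
have [psi psiP] := linear_extension sP nP1.
have [x xpsi] := functional_representation psi.
exists x => [|j Dj].
  apply: mem_biannihilator => // n nS; rewrite xpsi; last by case: nS.
  by apply/psiP/sub_sumsetr.
by rewrite xpsi; [apply/psiP/sub_sumsetl/mem_span|exact: local_e].
Qed.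

Lemma closed_subspace_extension Sigma (T : {linear config -> config}) y (D : set G) :
  prodiscrete_closed Sigma -> is_subspace Sigma ->
  (forall g, finitely_determined (fun x => T x g)) ->
  (forall F, (forall g, g \in F -> D g) -> exists2 x, Sigma x & agree F y (T x)) ->
  exists2 x, Sigma x & forall g, D g -> T x g = y g.
Proof.
move=> cS sS Tloc extend.
have [|s sD|x Sx xy] := linear_system_solvable (J := (G * index)%type)
  (e := fun p => evaluation p.1 p.2 \o T) (b := fun p => evaluation p.1 p.2 y)
  (D := [set p | D p.1]) cS sS.
- move=> p _; exists (evaluation p.1 p.2 \o T : {linear config -> K^o}) => //.
  by have [F TF] := Tloc p.1; exists F => u v /TF /= uv; rewrite /evaluation uv.
- have [|x Sx xy] := extend (map fst s); first by move=> _ /mapP[p /sD Dp ->].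
  by exists x => // p ps; rewrite /= /evaluation xy ?map_f.
- by exists x => // g Dg; apply: coord_inj => i; exact: (xy (g, i)).
Qed.

End LocalFunctionals.

Arguments local_functional {K A G} _.
Arguments finitely_supported {K A G} _.

Section LinearSubshifts.
Variables (K : fieldType) (A : vectType K) (G : groupType).
Local Notation config := (G -> A).
Local Notation dual := (config -> K^o).
Implicit Types (Sigma Lambda : set config) (x y z : config) (F : seq G).

Lemma local_functional_shift_support (n : dual) x :
  local_functional n -> finitely_supported x ->
  exists B : seq G, forall h, n (shift h x) != 0 -> h \in B.
Proof.
move=> [f -> [F fF]] [F' xF']; exists [seq (g * k^-1)%g | g <- F, k <- F'] => h.
apply: contraNT => hB; apply/eqP; rewrite -(fF 0) ?linear0 // => g gF; apply: xF'.
apply: contra hB => hg; have -> : h = (g * (h^-1 * g)^-1)%g by rewrite !gnorm.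
exact: allpairs_f.
Qed.

(* The annihilators form an ascending chain of submodules of the local functionals. *)
Lemma linear_subshift_dcc (S : nat -> set config) : polycyclic_by_finite G ->
  (forall i, linear_subshift (S i)) -> {homo S : i j / (i <= j)%N >-> j `<=` i} ->
  exists m, forall i, (m <= i)%N -> S m `<=` S i.
Proof.
move=> /polycyclic_by_finite_poly_Z[H pH iH] sS homoS.
have [W [_ acc] LW] := local_functional_noetherian A pH iH.
have [i|i j ij|m stab] := acc (fun i => annihilator (S i)).
- by apply: annihilator_submodule; case: (sS i).
- by apply: annihilatorS; exact: homoS.
exists m => i mi x Smx; have [cS _ vS] := sS i.
apply: mem_biannihilator => // n nSi.
by have [|_] := stab i mi n; [split=> //; apply: LW; case: nSi|exact].
Qed.

(* Prescribe [y] on [F] and [0] outside [E]: strong irreducibility solves every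
   finite part of this system. *)
Lemma finitely_supported_dense Lambda y F :
  linear_subshift Lambda -> strongly_irreducible Lambda -> Lambda y ->
  exists2 z, (Lambda `&` finitely_supported) z & agree F y z.
Proof.
move=> [cL _ vL] [D LD] Ly; have [L0 _ _] := vL.
pose E := [seq (g * d^-1)%g | g <- F, d <- (D : seq G)].
pose p : config := fun g => if g \in F then y g else 0.
have [g|F' F'FE|z Lz zp] := closed_subspace_extension (y := p) (T := idfun)
  (D := [set g | g \in F \/ g \notin E]) cL vL.
- by exists [:: g] => u v /= uv; rewrite uv ?mem_head.
- have [|z [Lz zy z0]] :=
    LD y 0 Ly L0 [fset g in F]%fset [fset g in F' | g \notin E]%fset.
    apply/eqP; rewrite -fsubset0; apply/fsubsetP => g; rewrite inE => /andP[].
    rewrite !inE /= => gF /imfset2P[/= h]; rewrite !inE /= => /andP[_ hE] [d dD ge].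
    by case/negP: hE; rewrite -(mulgK d h) -ge; exact: allpairs_f.
  exists z => // g gF'; rewrite /p /=; case: ifPn => gF; first by rewrite zy ?inE.
  have [gF2|gE] := F'FE g gF'; first by rewrite gF2 in gF.
  by rewrite z0 // !inE gF' gE.
- exists z; first split=> //.
    exists (F ++ E) => g; rewrite mem_cat negb_or => /andP[/negPf gF gE].
    by have /= := zp g (or_intror gE); rewrite /p gF.
  by move=> g gF; have /= := zp g (or_introl gF); rewrite /p gF.
Qed.

End LinearSubshifts.

Section LinearCellularAutomata.
Variables (K : fieldType) (A : vectType K) (G : groupType).
Local Notation config := (G -> A).
Local Notation dual := (config -> K^o).
Implicit Types (Sigma Lambda : set config) (x y z : config).

Lemma full_linear_CA_linear (T : config -> config) :
  full_linear_CA T -> exists L : {linear config -> config}, T = L.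
Proof.
move=> [M [mu muT]]; have T_linear : linear T.
  by move=> a x y; apply/funext => g; rewrite !addrfctE !scalrfctE !muT -linearP.
pose L : {linear config -> config} :=
  HB.pack T (GRing.isLinear.Build K config config *:%R T T_linear).
by exists L.
Qed.

Variable T : {linear config -> config}.
Hypothesis caT : full_linear_CA T.

Lemma CA_shift g x : T (shift g x) = shift g (T x).
Proof.
have [M [mu muT]] := caT; apply/funext => h; rewrite /shift !muT; congr (mu _).
by apply/funext => m; rewrite /shift !gnorm.
Qed.

Lemma CA_neighbourhood : exists M : {fset G}, forall x y g,
  (forall m, m \in M -> x (g * m)%g = y (g * m)%g) -> T x g = T y g.
Proof.
have [M [mu muT]] := caT; exists M => x y g xy; rewrite !muT; congr (mu _).
by apply/funext => m; rewrite /shift invgK xy //; exact: valP.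
Qed.

Lemma CA_finitely_determined g : finitely_determined (fun x => T x g).
Proof.
have [M TM] := CA_neighbourhood; exists [seq (g * m)%g | m <- (M : seq G)] => x y xy.
by apply: TM => m mM; rewrite xy ?map_f.
Qed.

Lemma precomp_CA_local (n : dual) :
  local_functional n -> local_functional (precomp T n).
Proof.
move=> [f -> [F fF]]; exists (f \o T : {linear config -> K^o}) => //.
have [M TM] := CA_neighbourhood.
exists [seq (g * m)%g | g <- F, m <- (M : seq G)] => x y xy /=; apply: fF => g gF.
by apply: TM => m mM; rewrite xy //; exact: allpairs_f.
Qed.

Lemma CA_finitely_supported x : finitely_supported x -> finitely_supported (T x).
Proof.
move=> [F xF]; have [M TM] := CA_neighbourhood.
exists [seq (f * m^-1)%g | f <- F, m <- (M : seq G)] => g gF.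
rewrite (TM x 0) ?linear0 // => m mM; apply: xF; apply: contra gF => gmF.
by rewrite -(mulgK m g); exact: allpairs_f.
Qed.

Lemma image_linear_subshift Sigma :
  linear_subshift Sigma -> linear_subshift (T @` Sigma).
Proof.
move=> [cS iS sS]; split; last exact: image_subspace.
  apply/prodiscrete_closedP => y yS.
  have [g|F _|x Sx xy] := closed_subspace_extension (T := T) (y := y) (D := setT) cS sS.
  - exact: CA_finitely_determined.
  - by have [_ [x Sx <-] xy] := yS F; exists x.
  - by exists x => //; apply/funext => g; exact: xy.
by move=> g _ [x Sx <-]; exists (shift g x); [exact: iS|exact: CA_shift].
Qed.

Lemma image_strongly_irreducible Sigma :
  strongly_irreducible Sigma -> strongly_irreducible (T @` Sigma).
Proof.
move=> [D SD]; have [M TM] := CA_neighbourhood.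
exists [fset (md * m^-1)%g | md in [fset (m * d)%g | m in M, d in D], m in M]%fset.
move=> _ _ [x Sx <-] [y Sy <-] E F EF.
have [|z [Sz zx zy]] := SD x y Sx Sy [fset (e * m)%g | e in E, m in M]%fset
    [fset (f * m)%g | f in F, m in M]%fset.
  apply/eqP; rewrite -fsubset0; apply/fsubsetP => g; rewrite inE => /andP[].
  move=> /imfset2P[/= e eE [m mM ->]].
  move=> /imfset2P[/= _ /imfset2P[/= f fF [m' m'M ->]] [d dD emf]].
  have : e \in (E `&` [fset (f * d)%g | f in F, d in
      [fset (md * m^-1)%g | md in [fset (m * d)%g | m in M, d in D], m in M]])%fset.
    rewrite inE eE /=; apply/imfset2P; exists f => //.
    exists (m' * d * m^-1)%g; last by rewrite !mulgA -emf mulgK.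
    by apply: in_imfset2 => //; exact: in_imfset2.
  by rewrite EF inE.
exists (T z); split; first by exists z.
- by move=> g gE; apply: TM => m mM; apply: zx; exact: in_imfset2.
- by move=> g gF; apply: TM => m mM; apply: zy; exact: in_imfset2.
Qed.

Section GardenOfEden.
Hypothesis hG : polycyclic_by_finite G.

Lemma surjective_pre_injective Sigma : shift_invariant Sigma -> vector_subspace Sigma ->
  Sigma `<=` T @` Sigma -> pre_injective Sigma T.
Proof.
move=> iS vS TS x y Sx Sy [F xyF] Txy; have [H pH iH] := polycyclic_by_finite_poly_Z hG.
have [W nW LW] := local_functional_noetherian A pH iH.
have Sxy : Sigma (x - y) := subspaceB vS Sx Sy.
have Txy0 : T (x - y) = 0 by rewrite linearB Txy subrr.
have fxy : finitely_supported (x - y).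
  by exists F => g gF; rewrite -[LHS]/(x g - y g) xyF // subrr.
suff eval0 n : local_functional n -> eval_at (x - y) n = 0.
  apply/eqP; rewrite -subr_eq0; apply/eqP/funext => g; apply: coord_inj => i.
  by rewrite linear0; exact: eval0 _ (evaluation_local g i).
move=> ln; have [B nB] := local_functional_shift_support ln fxy.
apply: (@vanishing_on_image_eq0 _ _ _ (dual_action A G) H (eval_at (x - y)) n
  [seq h^-1%g | h <- B] _ _ _ W local_functional (annihilator Sigma) (precomp T)) => //.
- exact: poly_Z_subgroup.
- exact: poly_Z_unique_products.
- by move=> h Hh /nB hB; rewrite -(invgK h) map_f.
- exact: local_functional_submodule.
- exact: annihilator_submodule.
- by move=> m [].
- by move=> h m; apply/funext => z; rewrite /= /precomp /= CA_shift.
- exact: precomp_CA_local.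
- by move=> m lm [_ mT]; split=> // z /TS[w Sw <-]; exact: mT.
- by move=> m [_]; exact.
- by move=> _ [f -> _]; rewrite -[LHS]/(f (T (x - y))) Txy0 linear0.
Qed.

Lemma pre_injective_surjective Lambda : linear_subshift Lambda ->
  strongly_irreducible Lambda -> set_fun Lambda Lambda T -> pre_injective Lambda T ->
  Lambda `<=` T @` Lambda.
Proof.
move=> sL irrL TL injT y Ly; have [_ iL vL] := sL.
have [H pH iH] := polycyclic_by_finite_poly_Z hG.
have [W nW FW] := finitely_supported_noetherian A pH iH.
have [cTL _ vTL] := image_linear_subshift sL.
apply: mem_biannihilator => // n [ln nT]; have [f ef [F fF]] := ln; subst n.
have [z [Lz fz] zy] := finitely_supported_dense F sL irrL Ly.
rewrite (fF _ _ zy); have [B fB] := local_functional_shift_support ln fz.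
have mL : is_submodule (shift_action A G) H Lambda by split=> // h v _; exact: iL.
apply: (@vanishing_on_image_eq0 _ _ _ (shift_action A G) H f z
  B _ _ _ W (Lambda `&` finitely_supported) [set 0] T) => //.
- exact: poly_Z_subgroup.
- exact: poly_Z_unique_products.
- by move=> h _; exact: fB.
- by move=> v [_ /FW].
- by apply: submoduleI => //; exact: finitely_supported_submodule.
- exact: submodule_set0.
- by move=> _ ->; split; [case: vL|exists [::]].
- exact: CA_shift.
- by move=> v [Lv fv]; split; [exact: TL|exact: CA_finitely_supported].
- move=> v [Lv [F' vF']] Tv; have [L0 _ _] := vL; apply: injT; rewrite ?linear0 //.
  by exists [fset g in F']%fset => g; rewrite !inE => /vF'.
- by move=> v ->; rewrite linear0.
- by move=> v [Lv _]; apply: nT; exists v.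
Qed.

End GardenOfEden.
End LinearCellularAutomata.

Section IteratedImages.
Variables (X : Type) (f : X -> X).

Lemma iter_image_ind (P : set X -> Prop) (S : set X) k :
  (forall R, P R -> P (f @` R)) -> P S -> P (iter k f @` S).
Proof.
move=> Pf PS; elim: k => [|k IH]; first by rewrite image_id.
by rewrite (_ : iter k.+1 f = f \o iter k f) // -image_comp; exact: Pf.
Qed.

Lemma iter_image_homo (S : set X) : set_fun S S f ->
  {homo (fun k => iter k f @` S) : i j / (i <= j)%N >-> j `<=` i}.
Proof.
move=> fS; apply: homo_leq => [P|Q P R QP RQ|k _ [x Sx <-]] //.
  exact: subset_trans QP.
by exists (f x); [exact: fS|rewrite -iterSr].
Qed.

End IteratedImages.

Lemma eq_set_fun (X Y : Type) (D : set X) (E : set Y) (f g : X -> Y) :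
  (forall x, D x -> f x = g x) -> set_fun D E f -> set_fun D E g.
Proof. by move=> fg fD x Dx /=; rewrite -fg //; exact: fD. Qed.

Section LimitSets.
Variables (K : fieldType) (A : vectType K) (G : groupType).
Local Notation config := (G -> A).
Implicit Types (Sigma Lambda : set config) (f : config -> config).

Lemma limit_set_sub Sigma f : set_fun Sigma Sigma f -> limit_set Sigma f `<=` Sigma.
Proof. by move=> fS x /(_ 1%N isT)[y Sy <-]; exact: fS. Qed.

Lemma limit_set_stable Sigma f : set_fun Sigma Sigma f ->
  set_fun (limit_set Sigma f) (limit_set Sigma f) f.
Proof.
move=> fS x limx k k1; have [y Sy <-] := limx k k1.
by exists (f y); [exact: fS|rewrite -iterSr].
Qed.

Lemma sub_limit_set Sigma Lambda f :
  Lambda `<=` Sigma -> Lambda `<=` f @` Lambda -> Lambda `<=` limit_set Sigma f.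
Proof.
move=> LS Lf; suff LfX k : Lambda `<=` iter k f @` Lambda.
  by move=> x /LfX Lx k _; have [y /LS Sy <-] := Lx k; exists y.
by apply: (iter_image_ind (P := subset Lambda)) => // R LR x /Lf[y /LR Ry <-]; exists y.
Qed.

Lemma stationary_limit_set Sigma f m : set_fun Sigma Sigma f ->
  (forall i, (m <= i)%N -> iter m f @` Sigma `<=` iter i f @` Sigma) ->
  limit_set Sigma f = iter m f @` Sigma.
Proof.
move=> fS stab; apply/seteqP; split=> [y /(_ m.+1 isT)|y ymS k _].
  exact: iter_image_homo.
have [mk|/ltnW km] := leqP m k; first exact: stab.
exact: (iter_image_homo fS km).
Qed.

Lemma eq_pre_injective Sigma f g : (forall x, Sigma x -> f x = g x) ->
  pre_injective Sigma f -> pre_injective Sigma g.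
Proof. by move=> fg injf x y Sx Sy xy; rewrite -!fg //; exact: injf. Qed.

Lemma eq_limit_set Sigma f g : (forall x, Sigma x -> f x = g x) ->
  set_fun Sigma Sigma f -> limit_set Sigma f = limit_set Sigma g.
Proof.
move=> fg fS; apply: eq_bigcapr => k _; apply: eq_imagel => x Sx.
suff [] : Sigma (iter k f x) /\ iter k f x = iter k g x by [].
by elim: k => //= k [Sk <-]; rewrite -fg //; split=> //; exact: fS.
Qed.

Variable T : {linear config -> config}.
Hypotheses (hG : polycyclic_by_finite G) (caT : full_linear_CA T).

Lemma limit_set_eventually Sigma : linear_subshift Sigma -> set_fun Sigma Sigma T ->
  exists m, forall i, (m <= i)%N -> limit_set Sigma T = iter i T @` Sigma.
Proof.
move=> sS TS; have TXS k : linear_subshift (iter k T @` Sigma).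
  by apply: iter_image_ind => // R; exact: image_linear_subshift.
have [m stab] := linear_subshift_dcc hG TXS (iter_image_homo TS).
exists m => i mi; apply: stationary_limit_set => // j ij.
exact: subset_trans (iter_image_homo TS mi) (stab j (leq_trans mi ij)).
Qed.

Lemma limit_set_surjective Sigma : linear_subshift Sigma -> set_fun Sigma Sigma T ->
  limit_set Sigma T `<=` T @` limit_set Sigma T.
Proof.
move=> sS TS; have [m limE] := limit_set_eventually sS TS.
rewrite {1}(limE m.+1) // (limE m) // => _ [x Sx <-].
by exists (iter m T x) => //; exists x.
Qed.

Lemma limit_set_linear_subshift Sigma : linear_subshift Sigma ->
  set_fun Sigma Sigma T -> linear_subshift (limit_set Sigma T).
Proof.
move=> sS TS; have [m /(_ m (leqnn m)) ->] := limit_set_eventually sS TS.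
by apply: iter_image_ind => // R; exact: image_linear_subshift.
Qed.

Lemma limit_set_strongly_irreducible Sigma : linear_subshift Sigma ->
  set_fun Sigma Sigma T -> strongly_irreducible Sigma ->
  strongly_irreducible (limit_set Sigma T).
Proof.
move=> sS TS irrS; have [m /(_ m (leqnn m)) ->] := limit_set_eventually sS TS.
by apply: iter_image_ind => // R; exact: image_strongly_irreducible.
Qed.

End LimitSets.

Theorem corollary1p7 (K : fieldType) (A : vectType K) (G : groupType)
  (Sigma : set (G -> A)) (tau : (G -> A) -> (G -> A))
  (hG : polycyclic_by_finite G)
  (hSigma : linear_subshift Sigma)
  (hirr : strongly_irreducible Sigma)
  (htau : linear_CA Sigma Sigma tau) :
  let good := fun Lambda : set (G -> A) =>
    [/\ linear_subshift Lambda,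
        strongly_irreducible Lambda,
        Lambda `<=` Sigma,
        set_fun Lambda Lambda tau
      & pre_injective Lambda tau] in
  good (limit_set Sigma tau) /\
  forall Lambda : set (G -> A), good Lambda -> Lambda `<=` limit_set Sigma tau.
Proof.
move=> good; have [tauS [T0 caT]] := htau.
have [T eT] := full_linear_CA_linear caT; subst T0 => tauT.
have TS := eq_set_fun tauT tauS; rewrite (eq_limit_set tauT tauS).
have limS := limit_set_sub TS.
have lim_sub := limit_set_linear_subshift hG caT hSigma TS.
have Ttau x : limit_set Sigma T x -> T x = tau x by move=> /limS Sx; rewrite tauT.
split=> [|Lambda [sL irrL LS tauL injL]].
  split=> //.
  - exact: limit_set_strongly_irreducible.
  - exact: eq_set_fun Ttau (limit_set_stable TS).
  - apply: (eq_pre_injective Ttau); have [_ ? ?] := lim_sub.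
    exact/surjective_pre_injective/limit_set_surjective.
have tauTL x : Lambda x -> tau x = T x by move=> /LS; exact: tauT.
apply: sub_limit_set => //; apply: pre_injective_surjective => //.
  exact: eq_set_fun tauTL tauL.
exact: eq_pre_injective tauTL injL.
Qed.
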